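(* For all $j\in\mathbb{Z}$ and all $a,b\in A$, the operator $T_j(a,b)$ is an affine central operator; that is, on every $\tau(A)$-module in category $\mathcal O$, $T_j(a,b)$ commutes with the action of $\tilde{\mathfrak g}=\tilde{\mathfrak g}\otimes 1$.
   Context: All vector spaces and tensor products are over $\mathbb{C}$. Let $\mathfrak g$ be a simple finite dimensional Lie algebra with Cartan subalgebra $\mathfrak h$, root system $\overset{\circ}{\Delta}$, positive roots $\overset{\circ}{\Delta}{}^+$, and normalized invariant bilinear form $(\cdot,\cdot)$ (the highest root $\beta$ has $(\beta,\beta)=2$). Let $\tilde{\mathfrak g}=\mathfrak g\otimes\mathbb{C}[t,t^{-1}]\oplus\mathbb{C}K$ with $K$ central and $[X\otimes t^n,Y\otimes t^m]=[X,Y]\otimes t^{m+n}+n\,\delta_{m+n,0}(X,Y)K$. Let $Vir=\bigoplus_{n\in\mathbb{Z}}\mathbb{C}L_n\oplus\mathbb{C}C_0$ with $C_0$ central and $[L_n,L_m]=(m-n)L_{n+m}+\delta_{n+m,0}\frac{n^3-n}{12}C_0$. Let $\bar\tau=Vir\ltimes\tilde{\mathfrak g}$ with $[L_n,X\otimes t^m]=mX\otimes t^{m+n}$ and $K$, $C_0$ central, and let $\tau=\bar\tau/\mathbb{C}(K-C_0)$. Write $d=L_0$ and $\bar{\mathfrak h}=\mathfrak h\oplus\mathbb{C}K\oplus\mathbb{C}d$. Let $A$ be a commutative associative finitely generated $\mathbb{C}$-algebra with unit; $\tau(A)=\tau\otimes A$ with $[X\otimes a,Y\otimes b]=[X,Y]\otimes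 ab$. Write $X(a)=X\otimes a$ for $X\in\tau$ and $X\otimes t^n(a)=(X\otimes t^n)\otimes a$ for $X\in\mathfrak g$; $\tau\subset\tau(A)$ via $X\mapsto X\otimes1$. Category $\mathcal O$: a $\tau(A)$-module $V$ is in $\mathcal O$ if (1) $V$ is a weight module for $\bar{\mathfrak h}$ with finite dimensional weight spaces; (2) for any $v\in V$, $a\in A$, one has $(X_\alpha\otimes a)v=0$ for all positive roots $\alpha\in\Delta^+$ of sufficiently large height and all $X_\alpha\in\tau_\alpha$. Here $\Delta=\{\alpha+n\delta,\,m\delta:\alpha\in\overset{\circ}{\Delta},n\in\mathbb{Z},0\ne m\in\mathbb{Z}\}$ are the roots of $\tau$ with respect to $\bar{\mathfrak h}$ ($\delta(\mathfrak h)=\delta(K)=0$, $\delta(d)=1$), with $\tau_{\alpha+n\delta}=\mathfrak g_\alpha\otimes t^n$, $\tau_{m\delta}=\mathfrak h\otimes t^m\oplus\mathbb{C}L_m$; $\Delta^+$ consists of $\overset{\circ}{\Delta}{}^+$ and all roots with positive $\delta$-coefficient; height is with respect to the simple roots $\alpha_0=\delta-\beta,\alpha_1,\dots,\alpha_l$. Let $\{h_i\},\{h^i\}$ be dual bases of $\mathfrak h$ with respect to $(\cdot,\cdot)$, and for $\alpha\in\overset{\circ}{\Delta}$ choose $x_\alpha\in\mathfrak g_\alpha$ with $(x_\alpha,x_{-\alpha})=1$. Let $\gamma:\mathfrak h\to\mathfrak h^*$ be the isomorphism given by the form, $\bar\rho$ the half-sum of positive roots of $\mathfrak g$, $h^\vee$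 the dual Coxeter number of $\mathfrak g$, and $\gamma^{-1}(\rho)=\gamma^{-1}(\bar\rho)+h^\vee d\in\bar{\mathfrak h}$. For $a,b\in A$ define, as operators on objects of $\mathcal O$, $$\Omega^1_{a,b}=\sum_{\alpha\in\overset{\circ}{\Delta}}\sum_{n>0}x_{-\alpha}\otimes t^{-n}(a)\,x_\alpha\otimes t^n(b),\quad \Omega^2_{a,b}=\sum_i\sum_{n>0}h_i\otimes t^{-n}(a)\,h^i\otimes t^n(b),\quad \Omega^3_{a,b}=\sum_{\alpha\in\overset{\circ}{\Delta}{}^+}x_{-\alpha}(a)x_\alpha(b),$$ $$\Omega(a,b)=2\gamma^{-1}(\rho)(ab)+\sum_i h_i(a)h^i(b)+K(a)d(b)+K(b)d(a)+\sum_{s=1}^3(\Omega^s_{a,b}+\Omega^s_{b,a}).$$ Set $T_0(a,b)=\Omega(a,b)$ and $T_j(a,b)=-\frac1j[L_j,\Omega(a,b)]$ for $j\ne0$. An operator $z$ acting on objects of $\mathcal O$ is called an affine central operator if $z$ commutes with $\tilde{\mathfrak g}$. *)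

(* Defs.v *)
(* The field of complex numbers is R[i] for a realType R. *)
From HB Require Import structures.
From mathcomp Require Import all_boot all_order all_algebra ring finmap.
From mathcomp Require Import boolp classical_sets functions cardinality fsbigop.
From mathcomp Require Export reals.
From mathcomp Require Export complex.

Set Implicit Arguments.
Unset Strict Implicit.
Unset Printing Implicit Defensive.

Import Order.TTheory GRing.Theory Num.Theory.
Local Open Scope classical_set_scope.
Local Open Scope ring_scope.

HB.mixin Record Lmodule_isLie (K : pzRingType) (L : Type)
    of GRing.Lmodule K L := {
  lie : L -> L -> L;
  lie_linearl : forall c x y z, lie (c *: x + y) z = c *: lie x z + lie y z;
  lie_linearr : forall c x y z, lie z (c *: x + y) = c *: lie z x + lie z y;
  liexx : forall x, lie x x = 0;
  lie_jacobi : forall x y z,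
    lie x (lie y z) + lie y (lie z x) + lie z (lie x y) = 0
}.

#[short(type="lieAlgType")]
HB.structure Definition LieAlgebra (K : pzRingType) :=
  {L of GRing.Lmodule K L & Lmodule_isLie K L}.

#[short(type="finLieAlgType")]
HB.structure Definition FinLieAlgebra (K : nzRingType) :=
  {L of Vector K L & Lmodule_isLie K L}.

Notation "[ 'lie' x , y ]" := (lie x y)
  (at level 0, x, y at level 99, format "[ 'lie'  x ,  y ]") : ring_scope.

Section LieTheory.
Variables (K : pzRingType) (L : lieAlgType K).
Implicit Types x y z : L.

Lemma lie0l x : [lie 0, x] = 0.
Proof.
have := lie_linearl 1 0 0 x; rewrite scaler0 addr0 scale1r => /eqP.
by rewrite -subr_eq0 opprD addNKr oppr_eq0 => /eqP.
Qed.

Lemma lie0r x : [lie x, 0] = 0.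
Proof.
have := lie_linearr 1 0 0 x; rewrite scaler0 addr0 scale1r => /eqP.
by rewrite -subr_eq0 opprD addNKr oppr_eq0 => /eqP.
Qed.

Lemma lieDl x y z : [lie x + y, z] = [lie x, z] + [lie y, z].
Proof. by have := lie_linearl 1 x y z; rewrite !scale1r. Qed.

Lemma lieDr x y z : [lie z, x + y] = [lie z, x] + [lie z, y].
Proof. by have := lie_linearr 1 x y z; rewrite !scale1r. Qed.

Lemma lieZl c x y : [lie c *: x, y] = c *: [lie x, y].
Proof. by have := lie_linearl c x 0 y; rewrite lie0l !addr0. Qed.

Lemma lieZr c x y : [lie y, c *: x] = c *: [lie y, x].
Proof. by have := lie_linearr c x 0 y; rewrite lie0r !addr0. Qed.

Lemma lieC x y : [lie x, y] = - [lie y, x].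
Proof.
apply/eqP; rewrite -addr_eq0; apply/eqP.
by have := liexx (x + y); rewrite lieDl !lieDr !liexx add0r addr0.
Qed.
End LieTheory.

Definition simple_lie (K : fieldType) (g : finLieAlgType K) : Prop :=
  (exists x y : g, [lie x, y] <> 0) /\
  (forall I : {vspace g},
     (forall x y, y \in I -> [lie x, y] \in I) -> I = 0%VS \/ I = fullv).

(* Nondegeneracy is not required: on a simple Lie algebra it follows from the
   normalization (beta, beta) = 2 of the highest root. *)
Record invForm (K : fieldType) (g : lieAlgType K) := InvForm {
  invform :> g -> g -> K;
  invform_linearl : forall c x y z,
    invform (c *: x + y) z = c * invform x z + invform y z;
  invform_sym : forall x y, invform x y = invform y x;
  invform_inv : forall x y z, invform [lie x, y] z = invform x [lie y, z]
}.

Section Tau.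
Variables (K : numFieldType) (g : lieAlgType K).

Definition finsupp (V : zmodType) (f : int -> V) : Prop :=
  finite_set [set n | f n != 0].

Definition tau_pred (X : (int -> g) * (int -> K^o) * K^o) : bool :=
  `[< finsupp X.1.1 /\ finsupp X.1.2 >].

(* Carrier of tau = (Vir |x g~) / C(K - C_0). The triple (f, p, c) stands for
     \sum_n f n (x) t^n + \sum_n p n L_n + c K,
   the central element C_0 of Vir being identified with K. The bracket depends
   on the form B, which is therefore a parameter of the type. *)
Record tau (B : invForm g) := Tau { tau_val : (int -> g) * (int -> K^o) * K^o;
                    tau_valP : tau_pred tau_val }.

Variable B : invForm g.

HB.instance Definition _ := [isSub for @tau_val B].
HB.instance Definition _ := [Choice of tau B by <:].

Lemma tau_pred_submod : GRing.submod_closed tau_pred.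
Proof.
have fin0 (V : zmodType) : finsupp (0 : int -> V).
  by rewrite /finsupp (_ : [set _ | _] = set0) // -subset0 => n /=; rewrite eqxx.
have finD (V : lmodType K) c (f f' : int -> V) :
    finsupp f -> finsupp f' -> finsupp (c *: f + f').
  move=> Ff Ff'; have := conj Ff Ff'; rewrite -finite_setU.
  apply: sub_finite_set => n /= nz; case: (eqVneq (f n) 0) => [f0|]; last by left.
  by right; apply: contra nz => /eqP f'0; rewrite addrfctE f'0 addr0
    (_ : (c *: f) n = c *: f n) // f0 scaler0.
split; first by apply/asboolP; split; exact: fin0.
move=> c X Y /asboolP[X1 X2] /asboolP[Y1 Y2].
by apply/asboolP; split; [apply: finD X1 Y1 | apply: finD X2 Y2].
Qed.

HB.instance Definition _ :=
  GRing.SubChoice_isSubLmodule.Build _ _ _ (tau B) tau_pred_submod.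

Definition loop_part (X : tau B) : int -> g := (tau_val X).1.1.
Definition vir_part (X : tau B) : int -> K^o := (tau_val X).1.2.
Definition central_part (X : tau B) : K^o := (tau_val X).2.

Definition vir_cocycle (n : int) : K := (n ^+ 3 - n)%:~R / 12.

(* The bilinear extension of
     [x t^i, y t^j] = [x, y] t^(i+j) + i delta_(i+j,0) B(x, y) K,
     [L_i, y t^j] = j y t^(i+j),
     [L_i, L_j] = (j - i) L_(i+j) + delta_(i+j,0) (i^3 - i)/12 K,
   see lie_loop, lie_virloop, lie_vir and lie_central below. *)
Definition tau_lie_raw (X Y : tau B) : (int -> g) * (int -> K^o) * K^o :=
  let f := loop_part X in let p := vir_part X in
  let f' := loop_part Y in let p' := vir_part Y in
  (fun n => \sum_(i \in [set: int]) ([lie f i, f' (n - i)]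
              + ((n - i)%:~R * p i) *: f' (n - i)
              - ((n - i)%:~R * p' i) *: f (n - i)),
   fun n => \sum_(i \in [set: int]) ((n - i - i)%:~R * p i * p' (n - i)) : K^o,
   \sum_(i \in [set: int]) (i%:~R * B (f i) (f' (- i))
              + vir_cocycle i * p i * p' (- i)) : K^o).

Definition tau_supp (X : tau B) : set int :=
  [set n | (loop_part X n != 0) || (vir_part X n != 0)].

Lemma tau_supp_fin X : finite_set (tau_supp X).
Proof.
case: X => -[[f p] c] XP; have /asboolP[/= Ff Fp] := XP.
have := conj Ff Fp; rewrite -finite_setU; apply: sub_finite_set => n /=.
by rewrite /tau_supp /loop_part /vir_part /= => /orP[]; [left|right].
Qed.

Lemma tau_suppPn X n : ~ tau_supp X n -> loop_part X n = 0 /\ vir_part X n = 0.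
Proof.
move=> /negP; rewrite /tau_supp /= negb_or !negbK => /andP[/eqP-> /eqP->].
by [].
Qed.

Lemma invform0l x : B 0 x = 0.
Proof.
have := invform_linearl B 1 0 0 x; rewrite scaler0 addr0 mul1r => /eqP.
by rewrite -subr_eq0 opprD addNKr oppr_eq0 => /eqP.
Qed.

Lemma invform0r x : B x 0 = 0.
Proof. by rewrite invform_sym invform0l. Qed.

Lemma invformZl c x y : B (c *: x) y = c * B x y.
Proof. by have := invform_linearl B c x 0 y; rewrite addr0 invform0l addr0. Qed.

Lemma invformZr c x y : B y (c *: x) = c * B y x.
Proof. by rewrite invform_sym invformZl invform_sym. Qed.

Lemma invformDl x y z : B (x + y) z = B x z + B y z.
Proof. by have := invform_linearl B 1 x y z; rewrite scale1r mul1r. Qed.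

Lemma invformDr x y z : B z (x + y) = B z x + B z y.
Proof. by rewrite !(invform_sym B z) invformDl. Qed.

Lemma tau_lie_subproof X Y : tau_pred (tau_lie_raw X Y).
Proof.
pose S := tau_supp X `|` tau_supp Y.
have Sfin : finite_set S by rewrite finite_setU; split; exact: tau_supp_fin.
pose T := [set (i + j)%R | i in S & j in S].
have Tfin : finite_set T by exact: finite_image2.
have S0 i : ~ S i -> [/\ loop_part X i = 0, vir_part X i = 0,
                      loop_part Y i = 0 & vir_part Y i = 0].
  move=> nS; have [nX nY] : ~ tau_supp X i /\ ~ tau_supp Y i.
    by split=> H; apply: nS; [left|right].
  by have [] := tau_suppPn nX; have [] := tau_suppPn nY.
have T0 n i : ~ T n -> ~ S i \/ ~ S (n - i).
  move=> nT; case: (pselect (S i)) => Si; last by left.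
  by right=> Sj; apply: nT; exists i => //; exists (n - i) => //; rewrite addrC subrK.
apply/asboolP; split; apply: sub_finite_set Tfin => n /=;
  move=> nz; apply: contrapT => nT; move/eqP: nz; apply;
  apply: fsbig1 => i _; have [/S0[fX pX fY pY]|/S0[fX pX fY pY]] := T0 n i nT.
- by rewrite fX pX pY lie0l !mulr0 !scale0r addr0 subr0.
- by rewrite fX fY lie0r !scaler0 addr0 subr0.
- by rewrite pX mulr0 mul0r.
- by rewrite pY mulr0.
Qed.

Definition tau_lie (X Y : tau B) : tau B := Tau B (tau_lie_subproof X Y).

Lemma tau_eq (X Y : tau B) :
  (forall n, loop_part X n = loop_part Y n) ->
  (forall n, vir_part X n = vir_part Y n) ->
  central_part X = central_part Y -> X = Y.
Proof.
move=> e1 e2 e3; apply: val_inj => /=; move: e1 e2 e3.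
rewrite /loop_part /vir_part /central_part.
case: (tau_val X) => -[f p] c; case: (tau_val Y) => -[f' p'] c' /= e1 e2 ->.
by rewrite (funext e1) (funext e2).
Qed.

Lemma loop_partP c X Y n :
  loop_part (c *: X + Y) n = c *: loop_part X n + loop_part Y n.
Proof. by []. Qed.
Lemma vir_partP c X Y n :
  vir_part (c *: X + Y) n = c *: vir_part X n + vir_part Y n.
Proof. by []. Qed.
Lemma central_partP c X Y :
  central_part (c *: X + Y) = c *: central_part X + central_part Y.
Proof. by []. Qed.

Lemma fsum_linear (V : lmodType K) (D : set int) (c : K) (F G H : int -> V) :
  finite_set D -> (forall i, ~ D i -> F i = 0) -> (forall i, ~ D i -> G i = 0) ->
  (forall i, H i = c *: F i + G i) ->
  \sum_(i \in [set: int]) H i =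
    c *: (\sum_(i \in [set: int]) F i) + \sum_(i \in [set: int]) G i.
Proof.
move=> Dfin F0 G0 HE.
have E (J : int -> V) : (forall i, ~ D i -> J i = 0) ->
    \sum_(i \in [set: int]) J i = \sum_(i <- fset_set D) J i.
  move=> J0; apply: fsbigTE => i; rewrite in_fset_set // => iD.
  by apply: J0 => Di; rewrite mem_set in iD.
rewrite !E //; last by move=> i Di; rewrite HE F0 // G0 // scaler0 addr0.
by rewrite scaler_sumr -big_split /=; apply: eq_bigr => i _; rewrite HE.
Qed.

Let regroup (V : zmodType) (x x' y y' z z' : V) :
  x + x' + (y + y') - (z + z') = x + y - z + (x' + y' - z').
Proof. by rewrite (addrACA x) opprD [LHS]addrACA. Qed.

Lemma tau_lie_linearl c X Y Z :
  tau_lie (c *: X + Y) Z = c *: tau_lie X Z + tau_lie Y Z.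
Proof.
pose D := tau_supp X `|` (tau_supp Y `|` tau_supp Z).
have Dfin : finite_set D by rewrite !finite_setU; do !split; exact: tau_supp_fin.
have D0 i : ~ D i -> [/\ loop_part X i = 0, vir_part X i = 0,
    loop_part Y i = 0, vir_part Y i = 0 & vir_part Z i = 0].
  move=> nD.
  have [|->->] := @tau_suppPn X i; first by move=> ?; apply: nD; left.
  have [|->->] := @tau_suppPn Y i; first by move=> ?; apply: nD; right; left.
  by have [|_ ->] := @tau_suppPn Z i; first by move=> ?; apply: nD; right; right.
apply: tau_eq => [n|n|].
- rewrite loop_partP /=; apply: (fsum_linear Dfin) => i.
  + by move/D0=> [-> -> _ _ ->]; rewrite lie0l !mulr0 !scale0r addr0 subr0.
  + by move/D0=> [_ _ -> -> ->]; rewrite lie0l !mulr0 !scale0r addr0 subr0.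
  rewrite !loop_partP vir_partP lie_linearl.
  rewrite [c *: _ i : K^o]/GRing.scale /= mulrDr scalerDl scalerDr regroup.
  by rewrite 2!scalerDr scalerN !scalerA mulrCA [in c * (_ * vir_part Z i)]mulrC.
- rewrite vir_partP /=; apply: (fsum_linear Dfin) => i.
  + by move/D0=> [_ -> _ _ _]; rewrite mulr0 mul0r.
  + by move/D0=> [_ _ _ -> _]; rewrite mulr0 mul0r.
  by rewrite vir_partP /GRing.scale /=; ring.
- rewrite central_partP /=; apply: (fsum_linear Dfin) => i.
  + by move/D0=> [-> -> _ _ _]; rewrite invform0l !mulr0 mul0r addr0.
  + by move/D0=> [_ _ -> -> _]; rewrite invform0l !mulr0 mul0r addr0.
  by rewrite loop_partP vir_partP invform_linearl /GRing.scale /=; ring.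
Qed.

Lemma tau_lie_linearr c X Y Z :
  tau_lie Z (c *: X + Y) = c *: tau_lie Z X + tau_lie Z Y.
Proof.
pose D := tau_supp X `|` (tau_supp Y `|` tau_supp Z).
have Dfin : finite_set D by rewrite !finite_setU; do !split; exact: tau_supp_fin.
have D0 i : ~ D i -> [/\ loop_part Z i = 0, vir_part X i = 0,
    vir_part Y i = 0 & vir_part Z i = 0].
  move=> nD.
  have [|_ ->] := @tau_suppPn X i; first by move=> ?; apply: nD; left.
  have [|_ ->] := @tau_suppPn Y i; first by move=> ?; apply: nD; right; left.
  by have [|-> ->] := @tau_suppPn Z i; first by move=> ?; apply: nD; right; right.
apply: tau_eq => [n|n|].
- rewrite loop_partP /=; apply: (fsum_linear Dfin) => i.
  + by move/D0=> [-> -> _ ->]; rewrite lie0l !mulr0 !scale0r addr0 subr0.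
  + by move/D0=> [-> _ -> ->]; rewrite lie0l !mulr0 !scale0r addr0 subr0.
  rewrite !loop_partP vir_partP lie_linearr.
  rewrite [c *: _ i : K^o]/GRing.scale /= mulrDr scalerDl scalerDr regroup.
  rewrite 2!scalerDr scalerN !scalerA [in c * (_ * vir_part X i)]mulrCA.
  by rewrite [in c * (_ * vir_part Z i)]mulrC.
- rewrite vir_partP /=; apply: (fsum_linear Dfin) => i.
  + by move/D0=> [_ _ _ ->]; rewrite mulr0 mul0r.
  + by move/D0=> [_ _ _ ->]; rewrite mulr0 mul0r.
  by rewrite vir_partP /GRing.scale /=; ring.
- rewrite central_partP /=; apply: (fsum_linear Dfin) => i.
  + by move/D0=> [-> _ _ ->]; rewrite invform0l !mulr0 mul0r addr0.
  + by move/D0=> [-> _ _ ->]; rewrite invform0l !mulr0 mul0r addr0.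
  rewrite loop_partP vir_partP invformDr invformZr /GRing.scale /=; ring.
Qed.

Lemma tau_loop_subproof (n : int) (x : g) :
  tau_pred ((fun m => if m == n then x else 0), (fun=> 0), 0).
Proof.
apply/asboolP; split; first last.
  by rewrite /finsupp (_ : [set _ | _] = set0) // -subset0 => m /=; rewrite eqxx.
apply: sub_finite_set (finite_set1 n) => m /=.
by case: (m =P n) => // _; rewrite eqxx.
Qed.

Lemma tau_vir_subproof (n : int) :
  tau_pred ((fun=> 0), (fun m => (m == n)%:R), 0).
Proof.
apply/asboolP; split.
  by rewrite /finsupp (_ : [set _ | _] = set0) // -subset0 => m /=; rewrite eqxx.
apply: sub_finite_set (finite_set1 n) => m /=.
by case: (m =P n) => // _; rewrite eqxx.
Qed.

Lemma tau_central_subproof : tau_pred ((fun=> 0), (fun=> 0), 1).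
Proof.
by apply/asboolP; split;
  rewrite /finsupp (_ : [set _ | _] = set0) // -subset0 => m /=; rewrite eqxx.
Qed.

Definition tau_loop (n : int) (x : g) : tau B := Tau B (tau_loop_subproof n x).
Definition tau_vir (n : int) : tau B := Tau B (tau_vir_subproof n).
Definition tau_K : tau B := Tau B tau_central_subproof.

Lemma loop_part_lie X Y n : loop_part (tau_lie X Y) n =
  \sum_(i \in [set: int]) ([lie loop_part X i, loop_part Y (n - i)]
    + ((n - i)%:~R * vir_part X i) *: loop_part Y (n - i)
    - ((n - i)%:~R * vir_part Y i) *: loop_part X (n - i)).
Proof. by []. Qed.

Lemma vir_part_lie X Y n : vir_part (tau_lie X Y) n =
  \sum_(i \in [set: int]) ((n - i - i)%:~R * vir_part X i * vir_part Y (n - i)).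
Proof. by []. Qed.

Lemma central_part_lie X Y : central_part (tau_lie X Y) =
  \sum_(i \in [set: int]) (i%:~R * B (loop_part X i) (loop_part Y (- i))
    + vir_cocycle i * vir_part X i * vir_part Y (- i)).
Proof. by []. Qed.

Lemma fsum_single (V : zmodType) (F : int -> V) m :
  (forall i, i != m -> F i = 0) -> \sum_(i \in [set: int]) F i = F m.
Proof.
move=> F0; rewrite (@fsbigTE _ _ _ _ [fset m]%fset) ?big_seq_fset1 //.
by move=> i; rewrite in_fset1; exact: F0.
Qed.

Lemma lie_loop m n x y : tau_lie (tau_loop m x) (tau_loop n y) =
  tau_loop (m + n) [lie x, y] + (if m + n == 0 then m%:~R * B x y else 0) *: tau_K.
Proof.
apply: tau_eq => [k|k|]; rewrite addrC.
- rewrite loop_partP loop_part_lie (fsum_single (m := m)) => [|i /negPf im];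
    rewrite /loop_part /vir_part /= ?im ?eqxx !mulr0 !scale0r addr0 subr0 ?lie0l //.
  rewrite [_ *: 0]scaler0 add0r subr_eq [n + m]addrC.
  by case: eqP; rewrite // lie0r.
- rewrite vir_partP vir_part_lie (fsum_single (m := m)) => [|i /negPf im];
    by rewrite /vir_part /= !mulr0 ?addr0 //; rewrite [_ *: 0]scaler0.
- rewrite central_partP central_part_lie (fsum_single (m := m)) => [|i /negPf im];
    rewrite /loop_part /vir_part /central_part /= ?im ?eqxx !mulr0 addr0 ?invform0l ?mulr0 //.
  rewrite addr0 /GRing.scale /= mulr1 (_ : (- m == n) = (m + n == 0)).
    by case: eqP => // _; rewrite invform0r mulr0.
  by rewrite addrC addr_eq0 eq_sym.
Qed.

Lemma lie_virloop m n y :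
  tau_lie (tau_vir m) (tau_loop n y) = n%:~R *: tau_loop (m + n) y.
Proof.
rewrite -[RHS]addr0; apply: tau_eq => [k|k|].
- rewrite loop_partP loop_part_lie (fsum_single (m := m)) => [|i /negPf im];
    rewrite /loop_part /vir_part /= ?im ?eqxx ?mulr0 ?mulr1 !scale0r ?addr0 ?subr0 lie0l ?add0r ?addr0 //.
  rewrite subr_eq [n + m]addrC; case: eqP => [->|_]; last by rewrite !scaler0.
  by rewrite [m + n]addrC addrK.
- rewrite vir_partP vir_part_lie (fsum_single (m := m)) => [|i /negPf im];
    by rewrite /vir_part /= !mulr0 ?addr0 //; rewrite [_ *: 0]scaler0.
- rewrite central_partP central_part_lie (fsum_single (m := m)) => [|i /negPf im];
    rewrite /loop_part /vir_part /central_part /= invform0l !mulr0 !addr0 //.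
  by rewrite [_ *: 0]scaler0.
Qed.

Lemma lie_loopvir m n x :
  tau_lie (tau_loop m x) (tau_vir n) = - m%:~R *: tau_loop (n + m) x.
Proof.
rewrite -[RHS]addr0; apply: tau_eq => [k|k|].
- rewrite loop_partP loop_part_lie (fsum_single (m := n)) => [|i /negPf im];
    rewrite /loop_part /vir_part /= ?im ?eqxx ?mulr0 ?mulr1 !scale0r ?addr0 ?subr0 lie0r ?add0r ?addr0 ?oppr0 //.
  rewrite subr_eq [n + m]addrC scaleNr; case: eqP => [->|_]; last by rewrite !scaler0.
  by rewrite addrK.
- rewrite vir_partP vir_part_lie (fsum_single (m := m)) => [|i /negPf im];
    by rewrite /vir_part /= !mulr0 ?mul0r ?addr0 //; rewrite [_ *: 0]scaler0.
- rewrite central_partP central_part_lie (fsum_single (m := m)) => [|i /negPf im];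
    rewrite /loop_part /vir_part /central_part /= invform0r !mulr0 mul0r !addr0 //.
  by rewrite [_ *: 0]scaler0.
Qed.

Lemma lie_vir m n : tau_lie (tau_vir m) (tau_vir n) =
  (n - m)%:~R *: tau_vir (m + n) + (if m + n == 0 then vir_cocycle m else 0) *: tau_K.
Proof.
apply: tau_eq => [k|k|].
- rewrite loop_partP loop_part_lie (fsum_single (m := m)) => [|i /negPf im];
    rewrite /loop_part /vir_part /= lie0l !scaler0 subr0 addr0 //.
- rewrite vir_partP vir_part_lie (fsum_single (m := m)) => [|i /negPf im];
    rewrite /vir_part /= ?im ?eqxx ?mulr0 ?mul0r // mulr1.
  rewrite [_ *: 0]scaler0 addr0 /GRing.scale /= subr_eq [n + m]addrC.
  by case: eqP => [->|]; rewrite ?mulr0 // [m + n]addrC addrK.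
- rewrite central_partP central_part_lie (fsum_single (m := m)) => [|i /negPf im];
    rewrite /loop_part /vir_part /central_part /= ?im ?eqxx invform0l ?mulr0 ?mul0r ?addr0 //.
  rewrite [_ *: 0]scaler0 !add0r /GRing.scale /= !mulr1 (_ : (- m == n) = (m + n == 0)).
    by case: (m + n == 0); rewrite /= ?mulr1 ?mulr0.
  by rewrite addrC addr_eq0 eq_sym.
Qed.

Lemma lie_central X : tau_lie tau_K X = 0.
Proof.
apply: tau_eq => [k|k|]; apply: fsbig1 => i _; rewrite /loop_part /vir_part /=.
- by rewrite lie0l mulr0 scale0r scaler0 subr0 addr0.
- by rewrite mulr0 mul0r.
- by rewrite invform0l !mulr0 mul0r addr0.
Qed.

Lemma tau_decomp X : exists A : seq int,
  X = \sum_(i <- A) (tau_loop i (loop_part X i) + vir_part X i *: tau_vir i)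
      + central_part X *: tau_K.
Proof.
pose A := fset_set (tau_supp X); exists A.
have supp0 n : n \notin A -> loop_part X n = 0 /\ vir_part X n = 0.
  rewrite in_fset_set; last exact: tau_supp_fin.
  by move=> nX; apply: tau_suppPn => Xn; rewrite mem_set in nX.
have dlt (V : zmodType) (F : int -> V) n :
    (n \notin A -> F n = 0) -> \sum_(i <- A) (if n == i then F i else 0) = F n.
  move=> F0; case: (boolP (n \in A)) => nA.
    rewrite (bigD1_seq n) ?fset_uniq //= eqxx big1 ?addr0 // => i /negPf ni.
    by rewrite eq_sym ni.
  rewrite F0 // big_seq big1 // => i iA; case: eqP => // ni.
  by rewrite ni iA in nA.
apply: tau_eq => [n|n|].
- pose h := fun Y : tau B => loop_part Y n.
  have hD : {morph h : Y Z / Y + Z} by [].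
  rewrite -/(h _) -[RHS]/(h _) hD (big_morph h hD (erefl : h 0 = 0)).
  rewrite -[LHS]addr0; congr (_ + _); last first.
    by rewrite /h /loop_part /=; symmetry; exact: scaler0.
  rewrite -(dlt _ (loop_part X) n : _ -> _ = h X); last by move=> /supp0[].
  apply: eq_bigr => i _; rewrite hD -[LHS]addr0; congr (_ + _).
  by rewrite /h /loop_part /=; symmetry; exact: scaler0.
- pose h := fun Y : tau B => vir_part Y n.
  have hD : {morph h : Y Z / Y + Z} by [].
  rewrite -/(h _) -[RHS]/(h _) hD (big_morph h hD (erefl : h 0 = 0)).
  rewrite -[LHS]addr0; congr (_ + _); last first.
    by rewrite /h /vir_part /=; symmetry; exact: scaler0.
  rewrite -(dlt _ (vir_part X) n : _ -> _ = h X); last by move=> /supp0[].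
  apply: eq_bigr => i _; rewrite hD -[LHS]add0r; congr (_ + _).
  rewrite -[RHS]/(vir_part X i * (n == i)%:R : K).
  by case: (n == i); rewrite /= ?mulr1 ?mulr0.
- pose h := fun Y : tau B => central_part Y.
  have hD : {morph h : Y Z / Y + Z} by [].
  rewrite -/(h _) -[RHS]/(h _) hD (big_morph h hD (erefl : h 0 = 0)).
  rewrite big1 ?add0r => [|i _]; last first.
    by rewrite hD /h /central_part /= add0r; exact: scaler0.
  by rewrite /h /central_part /=; symmetry; exact: (@mulr1 K).
Qed.

Lemma tau_ind (P : tau B -> Prop) :
  P 0 -> (forall c X Y, P X -> P Y -> P (c *: X + Y)) ->
  (forall n x, P (tau_loop n x)) -> (forall n, P (tau_vir n)) -> P tau_K ->
  forall X, P X.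
Proof.
move=> P0 Plin Pl Pv Pk X; have [A ->] := tau_decomp X.
rewrite addrC; apply: (Plin) => //; apply: (big_ind P) => // [Y Z PY PZ|i _].
  by rewrite -[Y]scale1r; exact: Plin.
by rewrite addrC; exact: Plin.
Qed.

Let lie0X X : tau_lie 0 X = 0.
Proof.
have := tau_lie_linearl 1 0 0 X; rewrite scaler0 addr0 scale1r => /eqP.
by rewrite -subr_eq0 opprD addNKr oppr_eq0 => /eqP.
Qed.

Let lieX0 X : tau_lie X 0 = 0.
Proof.
have := tau_lie_linearr 1 0 0 X; rewrite scaler0 addr0 scale1r => /eqP.
by rewrite -subr_eq0 opprD addNKr oppr_eq0 => /eqP.
Qed.

Let lieXK X : tau_lie X tau_K = 0.
Proof.
apply: tau_eq => [k|k|]; apply: fsbig1 => i _; rewrite /loop_part /vir_part /=.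
- by rewrite lie0r mulr0 scale0r scaler0 subr0 addr0.
- by rewrite mulr0.
- by rewrite invform0r !mulr0 addr0.
Qed.

Let loopN n x : tau_loop n (- x) = - tau_loop n x.
Proof.
apply: tau_eq => [k|k|]; last 2 first.
- by symmetry; exact: oppr0.
- by symmetry; exact: oppr0.
by rewrite -[RHS]/(- (if k == n then x else 0)) /loop_part /=; case: (k == n);
  rewrite ?oppr0.
Qed.

Let tau_skew X Y : tau_lie X Y + tau_lie Y X = 0.
Proof.
elim/tau_ind: X => [|c X X' IH IH'|m x|m|]; first by rewrite lie0X lieX0 addr0.
- rewrite tau_lie_linearl tau_lie_linearr addrACA -scalerDr IH IH'.
  by rewrite scaler0 addr0.
- elim/tau_ind: Y => [|c Y Y' IH IH'|n y|n|]; first by rewrite lie0X lieX0 addr0.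
  + rewrite tau_lie_linearl tau_lie_linearr addrACA -scalerDr IH IH'.
    by rewrite scaler0 addr0.
  + rewrite !lie_loop [n + m]addrC addrACA [ [lie y, x] ]lieC loopN subrr add0r.
    rewrite -scalerDl; case: eqP => [mn|_]; last by rewrite addr0 scale0r.
    rewrite (invform_sym B y) -mulrDl -intrD mn mul0r scale0r //.
  + by rewrite lie_loopvir lie_virloop scaleNr addNr.
  + by rewrite lie_central lieXK addr0.
- elim/tau_ind: Y => [|c Y Y' IH IH'|n y|n|]; first by rewrite lie0X lieX0 addr0.
  + rewrite tau_lie_linearl tau_lie_linearr addrACA -scalerDr IH IH'.
    by rewrite scaler0 addr0.
  + by rewrite lie_loopvir lie_virloop scaleNr addrN.
  + rewrite !lie_vir [n + m]addrC addrACA -!scalerDl -intrD.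
    rewrite -(opprB m n) addNr scale0r add0r.
    case: eqP => [/eqP mn|_]; last by rewrite addr0 scale0r.
    move: mn; rewrite addr_eq0 => /eqP ->; rewrite /vir_cocycle.
    by rewrite -mulrDl -intrD (_ : _ + _ = 0 :> int) ?mul0r ?scale0r //; ring.
  + by rewrite lie_central lieXK addr0.
- by rewrite lie_central lieXK addr0.
Qed.

Let tau_liexx X : tau_lie X X = 0.
Proof.
apply/eqP; have /eqP := tau_skew X X; rewrite -mulr2n -scaler_nat scaler_eq0.
by rewrite pnatr_eq0.
Qed.

Let J X Y Z :=
  tau_lie X (tau_lie Y Z) + tau_lie Y (tau_lie Z X) + tau_lie Z (tau_lie X Y).

Let J_cycle X Y Z : J X Y Z = J Y Z X.
Proof. by rewrite /J [RHS]addrC addrA. Qed.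

Let J_linear c X X' Y Z : J (c *: X + X') Y Z = c *: J X Y Z + J X' Y Z.
Proof.
rewrite /J !(tau_lie_linearl, tau_lie_linearr) 2!scalerDr.
by rewrite [X in X + _ = _]addrACA [LHS]addrACA.
Qed.

Let J0 Y Z : J 0 Y Z = 0.
Proof. by rewrite /J !(lie0X, lieX0) !addr0. Qed.

Let JK Y Z : J tau_K Y Z = 0.
Proof. by rewrite /J !(lie_central, lieXK, lie0X, lieX0) !addr0. Qed.

Let lieZ c X Y : tau_lie X (c *: Y) = c *: tau_lie X Y.
Proof. by have := tau_lie_linearr c Y 0 X; rewrite lieX0 !addr0. Qed.

Let lieDK c X Y : tau_lie X (Y + c *: tau_K) = tau_lie X Y.
Proof.
by rewrite addrC tau_lie_linearr lieXK scaler0 add0r.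
Qed.

Let loopD n x y : tau_loop n (x + y) = tau_loop n x + tau_loop n y.
Proof.
apply: tau_eq => [k|k|]; last 2 first.
- by rewrite -[RHS]/(0 + 0 : K^o) addr0.
- by rewrite -[RHS]/(0 + 0 : K^o) addr0.
rewrite -[RHS]/((if k == n then x else 0) + (if k == n then y else 0)).
by rewrite /loop_part /=; case: (k == n); rewrite ?addr0.
Qed.

Let loop0 n : tau_loop n 0 = 0.
Proof. by have := loopN n 0; rewrite oppr0 => /eqP; rewrite -addr_eq0 -loopD addr0 => /eqP. Qed.

Let Jlll a x b y c z : J (tau_loop a x) (tau_loop b y) (tau_loop c z) = 0.
Proof.
rewrite /J !(lie_loop, lieDK).
rewrite (_ : b + (c + a) = a + (b + c)); last by ring.
rewrite (_ : c + (a + b) = a + (b + c)); last by ring.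
rewrite [X in X + _ = _]addrACA [LHS]addrACA -!loopD lie_jacobi loop0 add0r -!scalerDl.
case: eqP => [abc|_]; last by rewrite !addr0 scale0r.
have -> : B y [lie z, x] = B x [lie y, z] by rewrite -invform_inv invform_sym.
have -> : B z [lie x, y] = B x [lie y, z] by rewrite invform_sym invform_inv.
by rewrite -!mulrDl -!intrD -addrA abc mul0r scale0r.
Qed.

Let Jllv a x b y c : J (tau_loop a x) (tau_loop b y) (tau_vir c) = 0.
Proof.
rewrite /J !(lie_loop, lie_loopvir, lie_virloop, lieDK, lieZ).
rewrite (_ : b + (c + a) = a + (c + b)); last by ring.
rewrite (_ : c + (a + b) = a + (c + b)); last by ring.
rewrite [ [lie y, x] ]lieC loopN (invform_sym B y) !scalerDr scalerN !scalerA.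
rewrite -scaleNr [X in X + _ = _]addrACA -!scalerDl addrAC -scalerDl.
rewrite (_ : - b%:~R - a%:~R + (a + b)%:~R = 0 :> K); last by ring.
rewrite scale0r add0r (_ : _ + _ = 0 :> K) ?scale0r //.
by case: eqP => _; ring.
Qed.

Let Jlvv a x b c : J (tau_loop a x) (tau_vir b) (tau_vir c) = 0.
Proof.
rewrite /J !(lie_loop, lie_vir, lie_loopvir, lie_virloop, lieDK, lieZ).
rewrite (_ : b + (c + a) = b + c + a); last by ring.
rewrite (_ : c + (b + a) = b + c + a); last by ring.
by rewrite !scalerA -!scalerDl (_ : _ + _ = 0 :> K) ?scale0r //; ring.
Qed.

Let Jvvv a b c : J (tau_vir a) (tau_vir b) (tau_vir c) = 0.
Proof.
rewrite /J !(lie_vir, lieDK, lieZ).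
rewrite (_ : b + (c + a) = a + (b + c)); last by ring.
rewrite (_ : c + (a + b) = a + (b + c)); last by ring.
rewrite !scalerDr !scalerA [X in X + _ = _]addrACA [LHS]addrACA -!scalerDl.
rewrite (_ : _ + _ = 0 :> K); last by ring.
rewrite scale0r add0r.
case: eqP => [abc|_]; last by rewrite !mulr0 !addr0 scale0r.
have -> : c = - (a + b) by rewrite -[RHS]add0r -abc; ring.
by rewrite /vir_cocycle (_ : _ + _ = 0 :> K) ?scale0r //; field.
Qed.

Lemma tau_jacobi X Y Z : J X Y Z = 0.
Proof.
have step (F : tau B -> tau B) : (forall c X Y, F (c *: X + Y) = c *: F X + F Y) ->
    F 0 = 0 -> F tau_K = 0 -> (forall n x, F (tau_loop n x) = 0) ->
    (forall n, F (tau_vir n) = 0) -> forall X, F X = 0.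
  move=> Flin F0 FK Fl Fv; apply: tau_ind => // c U V FU FV.
  by rewrite Flin FU FV scaler0 addr0.
have lin2 c U U' V W : J V (c *: U + U') W = c *: J V U W + J V U' W.
  by rewrite !(J_cycle V) J_linear.
have lin3 c U U' V W : J V W (c *: U + U') = c *: J V W U + J V W U'.
  by rewrite -!(J_cycle _ V) J_linear.
have JX0 U V : J U 0 V = 0 by rewrite J_cycle J0.
have JXX0 U V : J U V 0 = 0 by rewrite -J_cycle J0.
have JXK U V : J U tau_K V = 0 by rewrite J_cycle JK.
have JXXK U V : J U V tau_K = 0 by rewrite -J_cycle JK.
move: X; apply: (step (fun X => J X Y Z)) => // [a x|a].
- move: Y; apply: (step (fun Y => J _ Y Z)) => // [b y|b].
  + by move: Z; apply: (step (fun Z => J _ _ Z)).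
  + move: Z; apply: (step (fun Z => J _ _ Z)) => // c z.
    by rewrite -J_cycle Jllv.
- move: Y; apply: (step (fun Y => J _ Y Z)) => // [b y|b].
  + move: Z; apply: (step (fun Z => J _ _ Z)) => // [c z|c].
      by rewrite J_cycle Jllv.
    by rewrite J_cycle Jlvv.
  + move: Z; apply: (step (fun Z => J _ _ Z)) => // c z.
    by rewrite -J_cycle Jlvv.
Qed.

HB.instance Definition _ := Lmodule_isLie.Build K (tau B)
  tau_lie_linearl tau_lie_linearr tau_liexx tau_jacobi.
End Tau.

(* A module over the Lie algebra L (x) A, with bracket
   [X (x) a, Y (x) b] = [X, Y] (x) ab: by the universal property of the tensor
   product over K, a linear map L (x) A -> End(V) is a bilinear map
   L -> A -> End(V), and it is enough to check the bracket on pure tensors.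
   [M X a] is the operator X(a) = X (x) a. *)
Record currentModule (K : fieldType) (L : lieAlgType K) (A : comAlgType K)
    (V : lmodType K) := CurrentModule {
  cact :> L -> A -> V -> V;
  cact_linearL : forall a v, linear (fun X => cact X a v);
  cact_linearA : forall X v, linear (fun a => cact X a v);
  cact_linearV : forall X a, linear (cact X a);
  cact_lie : forall X Y a b v,
    cact [lie X, Y] (a * b) v = cact X a (cact Y b v) - cact Y b (cact X a v)
}.

Definition finitely_generated (K : fieldType) (A : comAlgType K) : Prop :=
  exists s : seq A, forall S : {pred A},
    GRing.subalg_closed S -> {subset s <= S} -> forall a, a \in S.

Section Cartan.
Variables (K : fieldType) (g : finLieAlgType K).

(* Definition of Cartan subalgebras for complex semisimple Lie algebras (Hall,
   Lie Groups, Lie Algebras, and Representations, Definition 7.10): abelian,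
   equal to their own centralizer, and acting diagonalizably on g. *)
Definition cartan_subalgebra (h : {vspace g}) : Prop :=
  [/\ forall H H', H \in h -> H' \in h -> [lie H, H'] = 0,
      forall y, (forall H, H \in h -> [lie H, y] = 0) -> y \in h
    & forall H, H \in h -> exists2 b : seq g, basis_of fullv b &
        forall y, y \in b -> exists c : K, [lie H, y] = c *: y].

Definition hdual (h : {vspace g}) := 'Hom(subvs_of h, K^o).

Variable h : {vspace g}.

Definition root_vector (alpha : hdual h) (y : g) : Prop :=
  forall H : subvs_of h, [lie vsval H, y] = (alpha H : K) *: y.

Definition roots : set (hdual h) :=
  [set alpha | alpha <> 0 /\ exists2 y, y <> 0 & root_vector alpha y].

Definition nonneg_comb (Pi : (\dim h).-tuple (hdual h)) (lambda : hdual h) :=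
  exists k : 'I_(\dim h) -> nat, lambda = \sum_i tnth Pi i *+ k i.

Definition simple_roots (Pi : (\dim h).-tuple (hdual h)) : Prop :=
  [/\ basis_of fullv Pi,
      forall i, roots (tnth Pi i)
    & forall alpha, roots alpha ->
        nonneg_comb Pi alpha \/ nonneg_comb Pi (- alpha)].

Variable Pi : (\dim h).-tuple (hdual h).

Definition pos_roots : set (hdual h) := roots `&` [set al | nonneg_comb Pi al].

Definition highest_root (beta : hdual h) : Prop :=
  roots beta /\ forall alpha, roots alpha -> nonneg_comb Pi (beta - alpha).

Definition rho_bar : hdual h := 2^-1 *: \sum_(alpha \in pos_roots) alpha.

Variable B : invForm g.

Definition gamma : 'Hom(subvs_of h, hdual h) :=
  linfun (fun H => linfun (fun H' => B (vsval H) (vsval H') : K^o)).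

Definition dual_form (lambda mu : hdual h) : K := lambda ((gamma^-1)%VF mu).

Definition coroot (alpha : hdual h) : subvs_of h :=
  (2 / dual_form alpha alpha) *: (gamma^-1)%VF alpha.

(* The coefficients of the coroot of beta in the simple coroots are the dual
   Kac labels a_1, ..., a_l; the label of the affine node is a_0 = 1. *)
Definition dual_coxeter (beta : hdual h) : K :=
  1 + \sum_(i < \dim h) coord [tuple coroot (tnth Pi i) | i < \dim h] i (coroot beta).

Definition dual_bases (hs hs' : (\dim h).-tuple (subvs_of h)) : Prop :=
  [/\ basis_of fullv hs, basis_of fullv hs'
    & forall i j, B (vsval (tnth hs i)) (vsval (tnth hs' j)) = (i == j)%:R].

Definition normalized_root_vectors (x : hdual h -> g) : Prop :=
  forall alpha, roots alpha ->
    root_vector alpha (x alpha) /\ B (x alpha) (x (- alpha)) = 1.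
End Cartan.

Section CategoryO.
Variables (K : numFieldType) (g : finLieAlgType K) (h : {vspace g}).
Variables (Pi : (\dim h).-tuple (hdual h)) (beta : hdual h) (B : invForm g).
Variables (A : comAlgType K) (V : lmodType K) (M : currentModule (tau B) A V).

(* (H, c, e) stands for H + c K + e d. *)
Definition hbar := (subvs_of h * K^o * K^o)%type.

Definition hbar_tau (H : hbar) : tau B :=
  tau_loop B 0 (vsval H.1.1) + (H.1.2 : K) *: tau_K B + (H.2 : K) *: tau_vir B 0.

Definition weight_space (lambda : 'Hom(hbar, K^o)) : set V :=
  [set v | forall H : hbar, M (hbar_tau H) 1 v = (lambda H : K) *: v].

Definition weight_module : Prop :=
  forall v, exists s : seq V,
    v = \sum_(w <- s) w /\
    (forall w, w \in s -> exists lambda, weight_space lambda w).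

Definition finite_dim_space (S : set V) : Prop :=
  exists s : seq V, forall v, S v ->
    exists c : 'I_(size s) -> K, v = \sum_i c i *: s`_i.

(* The pair (alpha, n) encodes alpha + n delta, a root when alpha is a root of
   g, or when alpha = 0 and n <> 0. *)
Definition affine_root (alpha : hdual h) (n : int) : Prop :=
  roots alpha \/ (alpha = 0 /\ n <> 0).

Definition affine_positive (alpha : hdual h) (n : int) : Prop :=
  affine_root alpha n /\ (0 < n \/ (n = 0 /\ pos_roots Pi alpha)).

Definition affine_root_vector (alpha : hdual h) (n : int) (X : tau B) : Prop :=
  (roots alpha /\ exists2 y, root_vector alpha y & X = tau_loop B n y) \/
  [/\ alpha = 0, n <> 0 & exists (H : subvs_of h) (c : K),
      X = tau_loop B n (vsval H) + c *: tau_vir B n].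

(* alpha + n delta = n alpha_0 + (alpha + n beta), where alpha_0 = delta - beta. *)
Definition height (alpha : hdual h) (n : int) : K :=
  n%:~R + \sum_(i < \dim h) coord Pi i (alpha + beta *~ n).

Definition category_O : Prop :=
  [/\ weight_module,
      forall lambda, finite_dim_space (weight_space lambda)
    & forall (v : V) (a : A), exists N : nat, forall alpha n,
        affine_positive alpha n -> N%:R <= height alpha n ->
        forall X, affine_root_vector alpha n X -> M X a v = 0].

Variables (hs hs' : (\dim h).-tuple (subvs_of h)) (x : hdual h -> g).

Definition gamma_inv_rho : tau B :=
  tau_loop B 0 (vsval (((gamma h B)^-1)%VF (rho_bar Pi)))
  + dual_coxeter Pi B beta *: tau_vir B 0.

(* \sum_(n \in S) is the sum over the n in S with a nonzero term, when there are
   finitely many of them, as is the case on every object of category O. *)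
Definition Omega1 (a b : A) (v : V) : V :=
  \sum_(alpha \in @roots K g h) \sum_(n \in [set n : nat | (0 < n)%N])
    M (tau_loop B (- n%:Z) (x (- alpha))) a (M (tau_loop B n%:Z (x alpha)) b v).

Definition Omega2 (a b : A) (v : V) : V :=
  \sum_(i < \dim h) \sum_(n \in [set n : nat | (0 < n)%N])
    M (tau_loop B (- n%:Z) (vsval (tnth hs i))) a
      (M (tau_loop B n%:Z (vsval (tnth hs' i))) b v).

Definition Omega3 (a b : A) (v : V) : V :=
  \sum_(alpha \in pos_roots Pi)
    M (tau_loop B 0 (x (- alpha))) a (M (tau_loop B 0 (x alpha)) b v).

Definition Omega (a b : A) (v : V) : V :=
  2 *: M gamma_inv_rho (a * b) v
  + \sum_(i < \dim h) M (tau_loop B 0 (vsval (tnth hs i))) a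
                        (M (tau_loop B 0 (vsval (tnth hs' i))) b v)
  + M (tau_K B) a (M (tau_vir B 0) b v)
  + M (tau_K B) b (M (tau_vir B 0) a v)
  + (Omega1 a b v + Omega1 b a v)
  + (Omega2 a b v + Omega2 b a v)
  + (Omega3 a b v + Omega3 b a v).

Definition T_op (j : int) (a b : A) (v : V) : V :=
  if j == 0 then Omega a b v
  else - (j%:~R)^-1 *:
    (M (tau_vir B j) 1 (Omega a b v) - Omega a b (M (tau_vir B j) 1 v)).

(* The subalgebra g (x) C[t, t^-1] + C K of tau is the set of elements with
   zero Virasoro component. *)
Definition affine_central (z : V -> V) : Prop :=
  forall X : tau B, (forall n, vir_part X n = 0) ->
  forall v, z (M X 1 v) = M X 1 (z v).
End CategoryO.

(* Main.v *)
From HB Require Import structures.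
From mathcomp Require Import all_boot all_order all_algebra.
From mathcomp Require Import ring zify.
From mathcomp Require Import boolp classical_sets fsbigop.
Require Import Defs.
Import Order.TTheory GRing.Theory Num.Theory.
Local Open Scope ring_scope.

Set Implicit Arguments.
Unset Strict Implicit.
Unset Printing Implicit Defensive.

(** Write S_n(a,b) = sum_p p1 t^-n(a) p2 t^n(b) over a pair of dual bases (p1, p2) of g.
    Since [x_al, x_-al] = gamma^-1(al), one has, with c = 2 h^vee,
      Omega(a,b) = S_0(a,b) + c d(ab) + K(a) d(b) + K(b) d(a)
                   + sum_(n > 0) (S_n(a,b) + S_n(b,a)).
    With Q_n(a,b) = sum_p [x,p1] t^(m-n)(a) p2 t^n(b), invariance of the form gives
      [x t^m, S_n(a,b)] = Q_n(a,b) - Q_(n+m)(a,b) + central terms, and reordering gives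
      Q_n(b,a) = - Q_(m-n)(a,b) + c x t^m(ab), where c is the Casimir eigenvalue on g.
    Hence the commutator of x t^m with the infinite sum telescopes symmetrically to
    c m x t^m(ab), which is cancelled by [x t^m, c d(ab)].  For j <> 0 the claim follows
    from the Jacobi identity, as [L_j, -] preserves the affine algebra.  The Casimir
    eigenvalue is computed on the highest root vector; the root theory it requires comes
    from vanishing traces of commutators on suitable sums of weight spaces. *)

(** * Symmetric partial sums over the integers *)

Section SymmetricTelescope.
Variable V : zmodType.
Implicit Types (u f : int -> V) (N : nat).

(** The sum of u over the integers from -N to N, with n and -n paired as S_n(a,b) and S_n(b,a) are
    in Omega. *)
Definition symsum N u : V :=
  u 0 + \sum_(1 <= n < N.+1) (u n%:Z + u (- n%:Z)).

Lemma symsumD N u f : symsum N (fun n => u n + f n) = symsum N u + symsum N f.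
Proof.
rewrite /symsum [RHS]addrACA -big_split; congr (_ + _).
by apply: eq_bigr => n _; rewrite addrACA.
Qed.

Lemma symsumN N u : symsum N (fun n => - u n) = - symsum N u.
Proof.
rewrite /symsum opprD -sumrN; congr (_ + _).
by apply: eq_bigr => n _; rewrite opprD.
Qed.

Lemma eq_symsum N u f : u =1 f -> symsum N u = symsum N f.
Proof. by move=> uf; rewrite /symsum uf; under eq_bigr do rewrite !uf. Qed.

Lemma symsum_telescope N u :
  symsum N (fun n => u n - u (n + 1)) = u (- N%:Z) - u (N%:Z + 1).
Proof.
rewrite /symsum; elim: N => [|N IHN]; first by rewrite big_nil addr0.
rewrite big_nat_recr //= addrA IHN.
rewrite (_ : - N.+1%:Z + 1 = - N%:Z); last by lia.
rewrite (_ : N.+1%:Z = N%:Z + 1 :> int); last by lia.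
by rewrite addrA subrKA addrC subrKA.
Qed.

(** Induction on m: each unit of the shift adds a telescoping sum, whose two endpoints lie where f
    is constantly C and constantly 0. The slack |m| in the bound on N keeps the shifted endpoints in
    these two ranges. *)
Lemma symsum_shift f (C : V) (N0 : nat) (m : int) (N : nat) :
    (forall n : int, N0%:Z <= n -> f n = 0) ->
    (forall n : int, n <= - N0%:Z -> f n = C) -> (N0 + `|m| <= N)%N ->
  symsum N (fun n => f n - f (n + m)) = C *~ m.
Proof.
move=> f_up f_dn; elim: m => [|m IHm|m IHm] le_N.
- rewrite (@eq_symsum _ _ (fun=> 0)) => [|n]; last by rewrite addr0 subrr.
  by rewrite /symsum big1 ?addr0 // => n _; rewrite addr0.
- rewrite (@eq_symsum _ _ (fun n => (f n - f (n + m%:Z)) +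
    (f (n + m%:Z) - f (n + 1 + m%:Z)))) => [|n]; last first.
    by rewrite addrA subrK (_ : n + 1 + _ = n + m.+1%:Z) //; lia.
  rewrite symsumD IHm; last by lia.
  rewrite (symsum_telescope N (fun n => f (n + m%:Z))) f_dn; last by lia.
  rewrite f_up; last by lia.
  by rewrite subr0 -mulrSr.
- rewrite (@eq_symsum _ _ (fun n => (f n - f (n - m%:Z)) +
    - (f (n - m.+1%:Z) - f (n + 1 - m.+1%:Z)))) => [|n]; last first.
    by rewrite opprB addrA (_ : n + 1 - _ = n - m%:Z) ?subrK //; lia.
  rewrite symsumD symsumN IHm; last by lia.
  rewrite (symsum_telescope N (fun n => f (n - m.+1%:Z))) f_dn; last by lia.
  rewrite f_up; last by lia.
  by rewrite subr0 !mulrNz -opprD -mulrSr.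
Qed.
End SymmetricTelescope.

(** * Linearity of the embeddings of g into the loop algebra *)

Section LoopAlgebra.
Variables (K : numFieldType) (g : lieAlgType K) (B : invForm g).

Lemma tau_loop_linear n : linear (tau_loop B n).
Proof.
move=> c x y; apply: tau_eq => [k|k|].
- by rewrite loop_partP /loop_part /=; case: eqP; rewrite // scaler0 addr0.
- by rewrite vir_partP /vir_part /= addr0; symmetry; exact: scaler0.
- by rewrite central_partP /central_part /= addr0; symmetry; exact: scaler0.
Qed.

HB.instance Definition _ n := GRing.isLinear.Build K g (tau B) _
  (tau_loop B n) (@tau_loop_linear n).

Lemma tau_lieE (X Y : tau B) : [lie X, Y] = tau_lie X Y.
Proof. by []. Qed.
End LoopAlgebra.

(** * Dual bases and the invariance of their canonical tensor *)

Section DualFamily.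
Variables (K : numFieldType) (g : lieAlgType K) (B : invForm g).
Variable D : seq (g * g).

(** Dual bases are encoded by their two expansion formulas, the form in which sums over them get
    rewritten. *)
Definition dual_family : Prop :=
  (forall y, y = \sum_(p <- D) B y p.2 *: p.1) /\
  (forall y, y = \sum_(p <- D) B y p.1 *: p.2).

Hypothesis dualD : dual_family.

Variables (V : lmodType K) (F : g -> g -> V).
Hypotheses (Fl : forall z, linear (F^~ z)) (Fr : forall z, linear (F z)).

Let Fl_sum (I : Type) (r : seq I) (c : I -> K) (y : I -> g) z :
  F (\sum_(i <- r) c i *: y i) z = \sum_(i <- r) c i *: F (y i) z.
Proof.
pose L := GRing.isLinear.Build K g V _ (F^~ z) (Fl z).
pose f : {linear g -> V} := HB.pack (F^~ z) L.
rewrite -[LHS]/(f _) linear_sum; apply: eq_bigr => i _; exact: (linearZ_LR f).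
Qed.

Let Fr_sum (I : Type) (r : seq I) (c : I -> K) (y : I -> g) z :
  F z (\sum_(i <- r) c i *: y i) = \sum_(i <- r) c i *: F z (y i).
Proof.
pose L := GRing.isLinear.Build K g V _ (F z) (Fr z).
pose f : {linear g -> V} := HB.pack (F z) L.
rewrite -[LHS]/(f _) linear_sum; apply: eq_bigr => i _; exact: (linearZ_LR f).
Qed.

(** Both sides expand to the double sum of B(p.1, q.1) F(q.2, p.2), by symmetry of the form. *)
Lemma dual_family_swap :
  \sum_(p <- D) F p.1 p.2 = \sum_(p <- D) F p.2 p.1.
Proof.
have [D1 D2] := dualD.
under eq_bigr => p _ do rewrite [X in F X _](D2 p.1) Fl_sum.
rewrite exchange_big; apply: eq_bigr => q _ /=.
rewrite [X in _ = F _ X](D2 q.1) Fr_sum; apply: eq_bigr => p _.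
by rewrite invform_sym.
Qed.

(** The canonical tensor, the sum of p.1 (x) p.2, is ad-invariant: by invariance of the form, the
    matrices of ad x in the two bases are negative transposes of each other. *)
Lemma dual_family_lie x :
  \sum_(p <- D) F [lie x, p.1] p.2 = - \sum_(p <- D) F p.1 [lie x, p.2].
Proof.
have [D1 D2] := dualD.
under eq_bigr => p _ do rewrite [X in F X _](D1 [lie x, p.1]) Fl_sum.
rewrite exchange_big -sumrN; apply: eq_bigr => q _ /=.
rewrite [X in F _ X](D2 [lie x, q.2]) Fr_sum -sumrN.
apply: eq_bigr => p _; rewrite -scaleNr; congr (_ *: _).
by rewrite lieC -scaleN1r invformZl invform_inv mulN1r invform_sym.
Qed.
End DualFamily.

(** By invariance the sum is that of B(x, [p.1, p.2]), which is antisymmetric under exchange of the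
    dual bases and hence equals its own negative. *)
Lemma dual_family_alternating (K : numFieldType) (g : lieAlgType K)
    (B : invForm g) (D : seq (g * g)) (x : g) :
  dual_family B D -> \sum_(p <- D) B [lie x, p.1] p.2 = 0.
Proof.
move=> dualD; set s := LHS.
have sE : s = \sum_(p <- D) B x [lie p.1, p.2].
  by apply: eq_bigr => p _; rewrite invform_inv.
have : s = - s.
  rewrite [LHS]sE -[RHS]/(- s) [in RHS]sE.
  rewrite [LHS](@dual_family_swap _ _ _ _ dualD K^o (fun y z => B x [lie y, z])).
  - rewrite -sumrN; apply: eq_bigr => p _.
    by rewrite [in LHS]lieC -scaleN1r invformZr mulN1r.
  - by move=> z k y y'; rewrite lieDl lieZl invformDr invformZr.
  - by move=> z c y y'; rewrite lieDr lieZr invformDr invformZr.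
by move/eqP; rewrite -addr_eq0 -mulr2n mulrn_eq0 => /eqP.
Qed.

(** * Sugawara operators and their commutators with the loop algebra *)

Section Sugawara.
Variables (K : numFieldType) (g : lieAlgType K) (B : invForm g).
Variables (A : comAlgType K) (V : lmodType K) (M : currentModule (tau B) A V).
Implicit Types (X Y : tau B) (x y : g) (a b : A) (v w : V) (m n : int).

HB.instance Definition _ X a := GRing.isLinear.Build K V V _
  (cact M X a) (@cact_linearV _ _ _ _ M X a).

Lemma act_linearX a v c X Y : M (c *: X + Y) a v = c *: M X a v + M Y a v.
Proof. exact: cact_linearL. Qed.

Lemma act0X a v : M 0 a v = 0.
Proof.
have := act_linearX a v 1 0 0; rewrite scaler0 addr0 scale1r => /eqP.
by rewrite -subr_eq0 opprD addNKr oppr_eq0 => /eqP.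
Qed.

Lemma actDX a v X Y : M (X + Y) a v = M X a v + M Y a v.
Proof. by have := act_linearX a v 1 X Y; rewrite !scale1r. Qed.

Lemma actZX a v c X : M (c *: X) a v = c *: M X a v.
Proof. by have := act_linearX a v c X 0; rewrite act0X !addr0. Qed.

Lemma act_comm X Y a b v :
  M X a (M Y b v) = M Y b (M X a v) + M [lie X, Y] (a * b) v.
Proof. by rewrite cact_lie addrC subrK. Qed.

Lemma act_K X a b v : M (tau_K B) b (M X a v) = M X a (M (tau_K B) b v).
Proof. by rewrite act_comm tau_lieE lie_central act0X addr0. Qed.

Notation L n y := (M (tau_loop B n y)).

Lemma loop_actP n a v : linear (fun y => L n y a v).
Proof. by move=> c y z; rewrite linearP act_linearX. Qed.

Lemma loop_act_sum n a v (I : Type) (r : seq I) (c : I -> K) (y : I -> g) :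
  L n (\sum_(i <- r) c i *: y i) a v = \sum_(i <- r) c i *: L n (y i) a v.
Proof.
pose F := GRing.isLinear.Build K g V _ _ (@loop_actP n a v).
pose f : {linear g -> V} := HB.pack (fun y => L n y a v) F.
rewrite -[LHS]/(f _) linear_sum; apply: eq_bigr => i _; exact: (linearZ_LR f).
Qed.

Lemma loop_comm m n x y a b v :
  L m x a (L n y b v) = L n y b (L m x a v) + L (m + n) [lie x, y] (a * b) v +
    (if m + n == 0 then m%:~R * B x y else 0) *: M (tau_K B) (a * b) v.
Proof. by rewrite act_comm tau_lieE lie_loop actDX actZX addrA. Qed.

Variables (D : seq (g * g)) (c : K).
Hypothesis dualD : dual_family B D.
Hypothesis casimir : forall x, \sum_(p <- D) [lie [lie x, p.1], p.2] = c *: x.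

(** The operator S_n(a,b); [sug_lie] is Q_n(a,b). *)
Definition sug n a b v : V :=
  \sum_(p <- D) L (- n) p.1 a (L n p.2 b v).

Definition sug_lie x m n a b v : V :=
  \sum_(p <- D) L (m - n) [lie x, p.1] a (L n p.2 b v).

Lemma sug_lieN x m n a b v :
  sug_lie x m n a b v = - \sum_(p <- D) L (m - n) p.1 a (L n [lie x, p.2] b v).
Proof.
apply: (dual_family_lie dualD (F := fun y z => L (m - n) y a (L n z b v))).
  by move=> z k y y'; exact: loop_actP.
by move=> z k y y'; rewrite linearP act_linearX linearP.
Qed.

(** Commuting the two factors of each term produces the Casimir sum c x t^m(ab) and a central term,
    which vanishes by [dual_family_alternating]. Moving ad x to the other factor and exchanging the
    dual bases identifies the rest with -Q_(m-n)(a,b). *)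
Lemma sug_lie_swap x m n a b v :
  sug_lie x m n b a v =
    - sug_lie x m (m - n) a b v + c *: L m x (a * b) v.
Proof.
have -> : sug_lie x m n b a v =
    (\sum_(p <- D) L n p.2 a (L (m - n) [lie x, p.1] b v))
      + c *: L m x (a * b) v.
  rewrite /sug_lie; under eq_bigr => p _ do rewrite loop_comm subrK (mulrC b).
  rewrite 2!big_split /= -addrA; congr (_ + _).
  rewrite -[RHS]addr0 -actZX -linearZ -casimir; congr (_ + _).
    under [in RHS]eq_bigr => p _ do rewrite -[ [lie _, _] ]scale1r.
    by rewrite loop_act_sum; apply: eq_bigr => p _; rewrite scale1r.
  rewrite -scaler_suml; case: (m == 0); last by rewrite big1 ?scale0r.
  by rewrite -mulr_sumr (dual_family_alternating _ dualD) mulr0 scale0r.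
congr (_ + _); rewrite sug_lieN opprK.
rewrite (dual_family_swap dualD
  (F := fun y z => L (m - (m - n)) y a (L (m - n) [lie x, z] b v))).
- by rewrite (_ : m - (m - n) = n) //; ring.
- by move=> z k y y'; exact: loop_actP.
- by move=> z k y y'; rewrite lieDr lieZr linearP act_linearX linearP.
Qed.

(** Leibniz rule on the two factors: each gives a bracket term, and a central term when its degree
    is -m. The central terms recombine by expanding x in the dual bases. *)
Lemma loop_sug x m n a b v :
  L m x 1 (sug n a b v) - sug n a b (L m x 1 v) =
    sug_lie x m n a b v - sug_lie x m (n + m) a b v
    + (if m == n then m%:~R *: M (tau_K B) a (L m x b v) else 0)
    + (if m == - n then m%:~R *: M (tau_K B) b (L m x a v) else 0).
Proof.
have [D1 D2] := dualD.
have step (p : g * g) :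
    L m x 1 (L (- n) p.1 a (L n p.2 b v)) =
      L (- n) p.1 a (L n p.2 b (L m x 1 v))
      + L (m - n) [lie x, p.1] a (L n p.2 b v)
      + L (- n) p.1 a (L (n + m) [lie x, p.2] b v)
      + ((if m == n then m%:~R * B x p.1 else 0) *: M (tau_K B) a (L n p.2 b v)
      + (if m == - n then m%:~R * B x p.2 else 0) *: L (- n) p.1 a (M (tau_K B) b v)).
  rewrite loop_comm mul1r (loop_comm m n) mul1r !linearD /= linearZ /=.
  rewrite addr_eq0 addr_eq0 opprK (addrC n).
  by rewrite [LHS](ACl (1*4*2*(5*3))%AC).
rewrite /sug linear_sum /=; under eq_bigr => p _ do rewrite step.
rewrite !big_split /= -!addrA addrC !addrA subrK.
rewrite -!addrA; congr (_ + _).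
rewrite sug_lieN opprK (_ : m - (n + m) = - n); last by ring.
congr (_ + _); congr (_ + _).
- case: eqP => [<-|_]; last by rewrite big1 // => p _; rewrite scale0r.
  rewrite [in RHS](D2 x) loop_act_sum linear_sum scaler_sumr /=.
  by apply: eq_bigr => p _; rewrite linearZ scalerA.
- case: eqP => [->|_]; last by rewrite big1 // => p _; rewrite scale0r.
  rewrite act_K [in RHS](D1 x) loop_act_sum scaler_sumr.
  by apply: eq_bigr => p _; rewrite scalerA.
Qed.

(** What category O provides for the argument: a bound uniform in y, so that the infinite sums are
    finite on each vector. *)
Definition smooth : Prop :=
  forall v a, exists N : nat, forall n y, N%:Z <= n -> L n y a v = 0.

(** Truncation of Omega(a,b) at degree N, with c standing for twice the dual Coxeter number. It
    agrees with Omega on a given vector for all large N, so commutators can be computed on finite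
    sums. *)
Definition sugawara (N : nat) a b v : V :=
  sug 0 a b v + c *: M (tau_vir B 0) (a * b) v
  + M (tau_K B) a (M (tau_vir B 0) b v) + M (tau_K B) b (M (tau_vir B 0) a v)
  + \sum_(1 <= n < N.+1) (sug n%:Z a b v + sug n%:Z b a v).

Lemma loop_d x m a v :
  L m x 1 (M (tau_vir B 0) a v) =
    M (tau_vir B 0) a (L m x 1 v) - m%:~R *: L m x a v.
Proof. by rewrite act_comm tau_lieE lie_loopvir actZX mul1r add0r scaleNr. Qed.

Lemma loop_K x m a v :
  L m x 1 (M (tau_K B) a v) = M (tau_K B) a (L m x 1 v).
Proof. by rewrite act_K. Qed.

(** By [sug_lie_swap], the (b,a) difference at n is the (a,b) difference at -n. The whole is thus a
    symmetric sum of f n - f (n + m), where f is 0 for large n and c x t^m(ab) for very negative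
    n. *)
Lemma sug_lie_symsum x m a b v : smooth ->
  exists N0 : nat, forall N : nat, (N0 <= N)%N ->
    sug_lie x m 0 a b v - sug_lie x m m a b v
    + \sum_(1 <= n < N.+1)
        ((sug_lie x m n%:Z a b v - sug_lie x m (n%:Z + m) a b v)
         + (sug_lie x m n%:Z b a v - sug_lie x m (n%:Z + m) b a v))
    = (m%:~R * c) *: L m x (a * b) v.
Proof.
move=> smoothV; have [Na Ha] := smoothV v a; have [Nb Hb] := smoothV v b.
pose f n := sug_lie x m n a b v.
(* [Nb] kills t^n(b) for large n, [Na] + |m| kills t^(m-n)(a) for very negative n, and the last |m|
   is the slack of [symsum_shift]. *)
exists (maxn Nb (Na + `|m|)%N + `|m|)%N => N le_N.
have f_up n : (maxn Nb (Na + `|m|)%N)%:Z <= n -> f n = 0.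
  move=> le_n; rewrite /f /sug_lie big1 // => p _.
  by rewrite Hb ?linear0 //; lia.
have f_dn n : n <= - (maxn Nb (Na + `|m|)%N)%:Z -> f n = c *: L m x (a * b) v.
  move=> le_n; rewrite /f sug_lie_swap /sug_lie big1 ?oppr0 ?add0r ?(mulrC b) // => p _.
  by rewrite Ha ?linear0 //; lia.
have := @symsum_shift V f _ _ m N f_up f_dn le_N.
rewrite -scaler_int scalerA => <-; rewrite /symsum add0r; congr (_ + _).
apply: eq_bigr => n _; congr (_ + _).
rewrite (sug_lie_swap x m n%:Z a b) (sug_lie_swap x m (n%:Z + m) a b) /f.
rewrite opprD opprK addrACA subrr addr0 addrC.
by rewrite (_ : m - (n%:Z + m) = - n%:Z) ?(addrC m) //; ring.
Qed.

(** The telescoped sum cancels against [x t^m, c d(ab)], and the central terms cancel against the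
    commutators with K(a) d(b) + K(b) d(a). *)
Lemma sugawara_loop x m a b v : smooth ->
  exists N0 : nat, forall N : nat, (N0 <= N)%N ->
    L m x 1 (sugawara N a b v) = sugawara N a b (L m x 1 v).
Proof.
move=> smoothV; have [N0 HN0] := sug_lie_symsum x m a b v smoothV.
(* The degree |m| must be within the truncation, since the central terms arise there. *)
exists (maxn N0 `|m|) => N le_N.
have /HN0 telescoped : (N0 <= N)%N by lia.
(* Total central contribution: m = n and m = -n give the same two terms, in opposite order. For m =
   0 no degree n > 0 contributes, in accordance with [Kd] being 0. *)
pose Kd : V := m%:~R *: M (tau_K B) a (L m x b v)
  + m%:~R *: M (tau_K B) b (L m x a v).
have central (n : nat) : (0 < n)%N -> L m x 1 (sug n a b v + sug n b a v) =
    (sug n a b (L m x 1 v) + sug n b a (L m x 1 v))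
    + ((sug_lie x m n a b v - sug_lie x m (n%:Z + m) a b v)
         + (sug_lie x m n b a v - sug_lie x m (n%:Z + m) b a v)
     + (if n == `|m|%N then Kd else 0)).
  move=> n_gt0; apply/eqP; rewrite [eqbRHS]addrC -subr_eq linearD opprD addrACA /=.
  rewrite !loop_sug [eqbLHS](AC (3*3) ((1*4)*((2*5)*(3*6))))%AC /=.
  apply/eqP; congr (_ + _).
  have [m_n|m_n] := eqVneq m n.
    have -> : (m == - n%:Z) = false by clear -m_n n_gt0; lia.
    have -> : (n == `|m|%N) by clear -m_n n_gt0; lia.
    by rewrite !addr0.
  have [m_Nn|m_Nn] := eqVneq m (- n%:Z).
    have -> : (n == `|m|%N) by clear -m_Nn n_gt0; lia.
    by rewrite !add0r addrC.
  have -> : (n == `|m|%N) = false by clear -m_n m_Nn n_gt0; lia.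
  by rewrite !addr0.
have sum_central : \sum_(1 <= n < N.+1) (if n == `|m|%N then Kd else 0) = Kd.
  have [m0|m_n0] := eqVneq m 0.
    by rewrite big1 => [|n _]; rewrite /Kd m0 !scale0r addr0 //; case: ifP.
  rewrite (bigD1_seq `|m|%N) ?iota_uniq ?mem_index_iota //=; last by lia.
  by rewrite eqxx big1 ?addr0 // => n /negPf->.
have E0 : L m x 1 (sug 0 a b v) =
    sug 0 a b (L m x 1 v) + (sug_lie x m 0 a b v - sug_lie x m m a b v).
  apply/eqP; rewrite [eqbRHS]addrC -subr_eq loop_sug add0r oppr0; apply/eqP.
  by case: eqP => [->|_]; rewrite ?scale0r !addr0.
have Ed k l : L m x 1 (M (tau_K B) k (M (tau_vir B 0) l v)) =
    M (tau_K B) k (M (tau_vir B 0) l (L m x 1 v))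
    - m%:~R *: M (tau_K B) k (L m x l v).
  by rewrite loop_K loop_d linearB linearZ.
have Es : L m x 1 (\sum_(1 <= n < N.+1) (sug n a b v + sug n b a v)) =
    \sum_(1 <= n < N.+1) (sug n a b (L m x 1 v) + sug n b a (L m x 1 v))
    + (\sum_(1 <= n < N.+1)
        ((sug_lie x m n%:Z a b v - sug_lie x m (n%:Z + m) a b v)
         + (sug_lie x m n%:Z b a v - sug_lie x m (n%:Z + m) b a v)) + Kd).
  rewrite -sum_central -!big_split linear_sum /=.
  by apply: eq_big_nat => n /andP[n_gt0 _]; exact: central.
rewrite /sugawara !linearD /= linearZ /= E0 loop_d !Ed Es scalerBr.
rewrite [LHS](AC (2*2*2*2*(1*2)) ((1*3*5*7*9)*((2*10)*4*(6*8*11))))%AC /=.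
rewrite telescoped (mulrC _ c) -scalerA subrr add0r.
by rewrite /Kd -opprD addNr addr0.
Qed.
End Sugawara.

(** * Simultaneous diagonalization *)

Import passmx.

(** Passing to matrices in a fixed basis reduces this to simultaneous diagonalization of commuting
    diagonalizable matrices; the rows of the base change matrix are the coordinates of the joint
    eigenvectors. *)
Lemma joint_eigenbasis (K : fieldType) (vT : vectType K) (fs : seq 'End(vT)) :
    {in fs &, forall f f' : 'End(vT), (f \o f' = f' \o f)%VF} ->
    (forall f : 'End(vT), f \in fs -> exists2 b : seq vT, basis_of fullv b &
       forall v, v \in b -> exists c : K, f v = c *: v) ->
  exists2 b : (\dim {:vT}).-tuple vT, basis_of fullv b &
    forall f : 'End(vT), f \in fs -> forall i, exists c : K, f b`_i = c *: b`_i.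
Proof.
move=> fs_comm fs_diag; set n := \dim _.
pose e : n.-tuple vT := vbasis fullv.
have e_basis : basis_of fullv e by exact: vbasisP.
have codiag : codiagonalizable [seq mxof e e f | f <- fs].
  apply/codiagonalizableP.
  split=> [_ _ /mapP[f f_fs ->] /mapP[f' f'_fs ->]|_ /mapP[f f_fs ->]].
    by rewrite /comm_mx -!(mxof_comp _ _ e_basis) fs_comm.
  have [b0 b0_basis b0_eig] := fs_diag f f_fs.
  have b0_size : size b0 == n by rewrite /n (@size_basis _ _ _ _ (in_tuple b0) b0_basis).
  pose b := Tuple b0_size.
  have b_eig (i : 'I_n) : exists c : K, f b`_i = c *: b`_i.
    by apply: b0_eig; rewrite mem_nth // size_tuple.
  have {}b_eig := choice b_eig.
  have [c cP] := b_eig; pose P : 'M[K]_n := \matrix_i rVof e b`_i.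
  have row_P i : row i P = rVof e b`_i by rewrite rowK.
  have Punit : P \in unitmx.
    rewrite -row_free_unit -kermx_eq0; apply/rowV0P => u /sub_kermxP uP.
    have /freeP/(_ (u 0)) b_free : free b by exact: basis_free b0_basis.
    apply/rowP => i; rewrite mxE; apply: b_free.
    apply: (can_inj (rVofK e_basis)); rewrite linear0 -[RHS]uP.
    rewrite linear_sum mulmx_sum_row; apply: eq_bigr => j _.
    by rewrite linearZ row_P.
  exists P => //; apply/diagonalizable_forPex; exists (\row_i c i).
  apply/simmxP => //; apply/row_matrixP => i.
  rewrite !row_mul row_diag_mx mxE -scalemxAl -rowE row_P.
  by rewrite -(rVof_app _ e_basis) // cP linearZ.
have [P Punit /allP Pdiag] := codiag.
pose b := [tuple vecof e (row i P) | i < n].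
have b_nth (i : 'I_n) : b`_i = vecof e (row i P).
  by rewrite -tnth_nth tnth_mktuple.
exists b.
  rewrite basisEfree subvf size_tuple leqnn !andbT; apply/freeP => k k0.
  suff : \row_i k i *m P = 0.
    move/(congr1 (mulmx^~ (invmx P))); rewrite mulmxK // mul0mx.
    by move=> /rowP kE i; have := kE i; rewrite !mxE.
  apply: (can_inj (vecofK e_basis)); rewrite linear0 -[RHS]k0.
  rewrite mulmx_sum_row linear_sum; apply: eq_bigr => j _.
  by rewrite linearZ b_nth mxE.
move=> f f_fs i; have [le_ni|lt_in] := leqP n i.
  by exists 0; rewrite nth_default ?size_tuple // scale0r linear0.
have /Pdiag/diagonalizable_forPex[D] : mxof e e f \in [seq mxof e e f | f <- fs].
  exact: map_f.
move/(simmxP Punit)/row_matrixP/(_ (Ordinal lt_in)).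
rewrite !row_mul row_diag_mx -scalemxAl -rowE => rowD.
exists (D 0 (Ordinal lt_in)); have -> := b_nth (Ordinal lt_in).
by rewrite (hom_vecof _ e_basis) // rowD linearZ.
Qed.

(** * Identities for brackets and for the invariant form *)

HB.instance Definition _ (K : pzRingType) (L : lieAlgType K) (x : L) :=
  GRing.isLinear.Build K L L _ (lie x) (fun c y z => lie_linearr c y z x).

Section LieCalculus.
Variables (K : pzRingType) (L : lieAlgType K).
Implicit Types x y z : L.

Lemma lie_derivation x y z :
  [lie x, [lie y, z]] = [lie [lie x, y], z] + [lie y, [lie x, z]].
Proof.
have := lie_jacobi x y z; rewrite (lieC z x) linearN (lieC z [lie x, y]) => /eqP.
by rewrite -addrA -opprD subr_eq0 [X in _ == X]addrC => /eqP.
Qed.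

Lemma lie_suml (I : Type) (r : seq I) (P : pred I) (F : I -> L) y :
  [lie \sum_(i <- r | P i) F i, y] = \sum_(i <- r | P i) [lie F i, y].
Proof.
rewrite lieC linear_sum -sumrN; apply: eq_bigr => i _.
by rewrite -lieC.
Qed.
End LieCalculus.

Section InvFormSums.
Variables (K : numFieldType) (g : lieAlgType K) (B : invForm g).

Lemma invformNl y z : B (- y) z = - B y z.
Proof. by rewrite -scaleN1r invformZl mulN1r. Qed.

Lemma invform_suml (I : Type) (r : seq I) (P : pred I) (F : I -> g) z :
  B (\sum_(i <- r | P i) F i) z = \sum_(i <- r | P i) B (F i) z.
Proof.
by apply: (big_morph (fun y => B y z)) => [y y'|]; rewrite ?invformDl ?invform0l.
Qed.

Lemma invform_sumr (I : Type) (r : seq I) (P : pred I) (F : I -> g) z :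
  B z (\sum_(i <- r | P i) F i) = \sum_(i <- r | P i) B z (F i).
Proof.
rewrite invform_sym invform_suml; apply: eq_bigr => i _; exact: invform_sym.
Qed.
End InvFormSums.

(** * Weight vectors and a weight basis of g *)

Section WeightVectors.
Variables (K : numFieldType) (g : finLieAlgType K) (h : {vspace g}).
Implicit Types (al be : hdual h) (y z : g).

Lemma root_vectorZ al c y : root_vector al y -> root_vector al (c *: y).
Proof. by move=> aly H; rewrite lieZr aly !scalerA mulrC. Qed.

Lemma root_vector_lie al be y z :
  root_vector al y -> root_vector be z -> root_vector (al + be) [lie y, z].
Proof.
move=> aly bez H; rewrite lie_derivation aly bez lieZl lieZr -scalerDl.
by rewrite add_lfunE.
Qed.

(** As h is abelian, the operators ad y for y in a basis of h commute by Jacobi; their joint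
    eigenvectors are eigenvectors for all of h by linearity. *)
Lemma ad_eigenbasis : cartan_subalgebra h ->
  exists2 bs : (\dim {:g}).-tuple g, basis_of fullv bs &
    forall H : subvs_of h, forall i, exists c : K, [lie vsval H, bs`_i] = c *: bs`_i.
Proof.
case=> h_comm _ h_diag.
pose fs := [seq linfun (lie y) | y <- vbasis h].
have [||bs bs_basis bs_eig] := @joint_eigenbasis K g fs.
- move=> _ _ /mapP[y /vbasis_mem yh ->] /mapP[z /vbasis_mem zh ->].
  apply/lfunP => w; rewrite !comp_lfunE !lfunE /=.
  by rewrite lie_derivation (h_comm y z) // lie0l add0r.
- move=> _ /mapP[y /vbasis_mem yh ->]; have [b b_basis b_eig] := h_diag y yh.
  by exists b => // v /b_eig[c cP]; exists c; rewrite lfunE.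
exists bs => // H i.
have {}bs_eig (j : 'I_(\dim h)) : exists c : K, [lie (vbasis h)`_j, bs`_i] = c *: bs`_i.
  have /bs_eig/(_ i)[c] : linfun (lie (vbasis h)`_j) \in fs.
    by apply: map_f; rewrite mem_nth // size_tuple.
  by rewrite lfunE /= => cP; exists c.
have [c cP] := choice bs_eig.
exists (\sum_j coord (vbasis h) j (vsval H) * c j).
rewrite {1}(coord_vbasis (subvsP H)) lie_suml scaler_suml.
by apply: eq_bigr => j _; rewrite lieZl cP scalerA.
Qed.

Lemma weight_basis : cartan_subalgebra h ->
  exists (bs : (\dim {:g}).-tuple g) (mu : 'I_(\dim {:g}) -> hdual h),
    basis_of fullv bs /\ forall i, root_vector (mu i) bs`_i.
Proof.
move=> /ad_eigenbasis[bs bs_basis bs_eig].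
(* Reading the eigenvalue off as a coordinate of the bracket makes it visibly linear in H. *)
pose wt i (H : subvs_of h) : K^o := coord bs i [lie vsval H, bs`_i].
have wt_lin i : linear (wt i).
  by move=> c H H'; rewrite /wt linearP lieDl lieZl linearP.
exists bs, (fun i => linfun (HB.pack_for {linear subvs_of h -> K^o} (wt i)
  (GRing.isLinear.Build K (subvs_of h) K^o _ (wt i) (wt_lin i)))).
split=> // i H; rewrite lfunE /= /wt; have [c ->] := bs_eig H i.
by rewrite linearZ /= coord_free ?(basis_free bs_basis) // eqxx mulr1.
Qed.
End WeightVectors.

(** The Casimir operator commutes with ad z because the canonical tensor is invariant; its
    eigenspaces are therefore ideals. *)
Lemma casimir_lie (K : numFieldType) (g : lieAlgType K) (B : invForm g)
    (D : seq (g * g)) (y z : g) : dual_family B D ->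
  \sum_(p <- D) [lie [lie [lie z, y], p.1], p.2] =
    [lie z, \sum_(p <- D) [lie [lie y, p.1], p.2]].
Proof.
move=> dualD; rewrite linear_sum /=; under [RHS]eq_bigr => p _ do
  rewrite lie_derivation lie_derivation lieDl -addrA.
rewrite big_split /= big_split /=.
rewrite (dual_family_lie dualD (F := fun u v => [lie [lie y, u], v])).
- by rewrite addNr addr0.
- by move=> w k u v; rewrite linearP lie_linearl.
- by move=> w k u v; rewrite linearP.
Qed.

(** * Weight decomposition and nondegeneracy of the form *)

Section RootTheory.
Variables (K : numFieldType) (g : finLieAlgType K) (h : {vspace g}).
Variables (B : invForm g) (hs hs' : (\dim h).-tuple (subvs_of h)).
Hypotheses (g_simple : simple_lie g) (h_cartan : cartan_subalgebra h).
Hypothesis hs_dual : dual_bases B hs hs'.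
Variables (bs : (\dim {:g}).-tuple g) (mu : 'I_(\dim {:g}) -> hdual h).
Hypothesis bs_basis : basis_of fullv bs.
Hypothesis bs_wt : forall i, root_vector (mu i) bs`_i.
Implicit Types (al be : hdual h) (y z : g) (H : subvs_of h).

Local Notation I := 'I_(\dim {:g}).

Local Notation co i y := (coord bs i y).

Lemma weight_basis_neq0 (i : I) : bs`_i != 0.
Proof.
by apply: (free_not0 (basis_free bs_basis)); rewrite mem_nth // size_tuple.
Qed.

Lemma coordE y : y = \sum_i co i y *: bs`_i.
Proof. exact: coord_basis bs_basis (memvf y). Qed.

Lemma coord_bs (i j : I) : co j bs`_i = (i == j)%:R.
Proof. exact: coord_free (basis_free bs_basis). Qed.

Lemma coord_ad H y i : co i [lie vsval H, y] = (mu i H : K) * co i y.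
Proof.
rewrite {1}(coordE y) !linear_sum /= (bigD1 i) //= big1 => [|j ji].
  by rewrite addr0 lieZr bs_wt !linearZ /= coord_bs eqxx mulr1 mulrC.
by rewrite lieZr bs_wt !linearZ /= coord_bs (negPf ji) !mulr0.
Qed.

Lemma weight_coord al y i : root_vector al y -> co i y != 0 -> mu i = al.
Proof.
move=> aly yi; apply/lfunP => H; apply: (mulIf yi).
by rewrite -[LHS]coord_ad aly linearZ.
Qed.

Lemma weight_expand al y : root_vector al y ->
  y = \sum_(i | mu i == al) co i y *: bs`_i.
Proof.
move=> aly; rewrite {1}(coordE y) [RHS]big_mkcond; apply: eq_bigr => i _.
case: ifP => // /eqP mu_i; have [->|] := eqVneq (co i y) 0.
  by rewrite scale0r.
by move/(weight_coord aly).
Qed.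

Lemma weight0P y : root_vector (0 : hdual h) y <-> y \in h.
Proof.
have [h_comm h_self _] := h_cartan; split=> [y0|yh H].
  apply: h_self => H Hh; rewrite -(vsprojK Hh) y0.
  by rewrite zero_lfunE scale0r.
by rewrite h_comm ?subvsP // zero_lfunE scale0r.
Qed.

(** The line through z is an ideal; were it all of g, then g would be abelian. *)
Lemma center_trivial z : (forall y, [lie z, y] = 0) -> z = 0.
Proof.
move=> z_central; have [[y [w yw]] g_ideals] := g_simple.
have [x v /vlineP[k ->]||] := g_ideals <[z]>%VS.
- by rewrite lieZr lieC z_central oppr0 scaler0 mem0v.
- by move=> z0; apply/eqP; rewrite -memv0 -z0 memv_line.
move=> z_full; have : y \in <[z]>%VS by rewrite z_full memvf.
by case/vlineP => k yE; case: yw; rewrite yE lieZl z_central scaler0.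
Qed.

Lemma h_coord H i : coord hs i H = B (vsval H) (vsval (tnth hs' i)).
Proof.
have [hs_basis _ hsB] := hs_dual.
rewrite {2}(coord_basis hs_basis (memvf H)) linear_sum /= invform_suml.
rewrite (bigD1 i) //= big1 => [|j ji]; rewrite invformZl -tnth_nth hsB.
  by rewrite eqxx mulr1 addr0.
by rewrite (negPf ji) mulr0.
Qed.

Lemma h_expand H :
  H = \sum_i B (vsval H) (vsval (tnth hs' i)) *: tnth hs i.
Proof.
have [hs_basis _ _] := hs_dual.
rewrite {1}(coord_basis hs_basis (memvf H)); apply: eq_bigr => i _.
by rewrite h_coord -tnth_nth.
Qed.

Lemma invform_h_inj H H' :
  (forall H0, B (vsval H) (vsval H0) = B (vsval H') (vsval H0)) -> H = H'.
Proof.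
move=> BH; rewrite [H]h_expand [RHS]h_expand.
by apply: eq_bigr => i _; rewrite BH.
Qed.

(** The radical is an ideal, written as the kernel of a linear map. Were it all of g, the dual bases
    would force h = 0, so g, being the centralizer of h, would equal h and be abelian. *)
Lemma invform_nondegenerate y : (forall z, B y z = 0) -> y = 0.
Proof.
pose Brow0 z : 'rV[K]_(\dim {:g}) := \row_(i < \dim {:g}) B z bs`_i.
have Brow_lin : linear Brow0.
  by move=> k y1 y2; apply/rowP => i; rewrite !mxE invform_linearl.
pose Brow := HB.pack_for {linear g -> 'rV[K]_(\dim {:g})} Brow0
  (GRing.isLinear.Build K g _ _ Brow0 Brow_lin).
have kerP z : reflect (forall w, B z w = 0) (z \in lker (linfun Brow)).
  rewrite memv_ker lfunE; apply: (iffP eqP) => [/rowP z0 w|z0].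
    rewrite (coordE w) invform_sumr big1 // => i _.
    by have := z0 i; rewrite !mxE invformZr => ->; rewrite mulr0.
  by apply/rowP => i; rewrite !mxE z0.
move=> /kerP; have [_ g_ideals] := g_simple.
have [|->|ker_full _] := g_ideals (lker (linfun Brow)).
- by move=> x z /kerP z0; apply/kerP => w; rewrite lieC invformNl invform_inv z0 oppr0.
- by rewrite memv0 => /eqP.
have B0 z w : B z w = 0 by apply/(kerP z); rewrite ker_full memvf.
have h0 H : H = 0.
  by rewrite [H]h_expand big1 // => i _; rewrite B0 scale0r.
have [[z [w zw]] _] := g_simple; have [h_comm h_self _] := h_cartan.
case: zw; apply: h_comm; apply: h_self => H Hh;
  by rewrite -(vsprojK Hh) (h0 (vsproj h H)) linear0 lie0l.
Qed.

Lemma invform_weight al be y z : root_vector al y -> root_vector be z ->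
  al + be <> 0 -> B y z = 0.
Proof.
move=> aly bez albe; apply/eqP/negPn/negP => Byz; apply: albe.
apply/lfunP => H; rewrite zero_lfunE add_lfunE; apply: (mulIf Byz).
rewrite mul0r mulrDl -[X in X + _ = _]invformZl -[X in _ + X = _]invformZr.
by rewrite -aly -bez lieC invformNl invform_inv addNr.
Qed.

Lemma dual_weight al y : root_vector al y -> y <> 0 ->
  exists2 i : I, mu i = - al & B y bs`_i != 0.
Proof.
move=> aly y_n0; apply/not_exists2P => noi; apply: y_n0.
apply: invform_nondegenerate => z; rewrite (coordE z) invform_sumr big1 // => i _.
rewrite invformZr; have [mu_i|mu_i] := eqVneq (mu i) (- al).
  by have [|/negP/negPn/eqP->] := noi i; rewrite ?mulr0.
rewrite (invform_weight aly (bs_wt i)) ?mulr0 //.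
by move/eqP; rewrite addrC addr_eq0 (negPf mu_i).
Qed.

(** [gamma] applies [linfun] to bare functions, so it can be evaluated only once linearity in each
    argument has been supplied. *)
Lemma gammaE H H' : gamma h B H H' = B (vsval H) (vsval H').
Proof.
pose f1 H1 H2 : K^o := B (vsval H1) (vsval H2).
have lin1 H1 : linear (f1 H1).
  by move=> k H2 H3; rewrite /f1 linearP invformDr invformZr.
pose F1 H1 := HB.pack_for {linear subvs_of h -> K^o} (f1 H1)
  (GRing.isLinear.Build K (subvs_of h) K^o _ (f1 H1) (lin1 H1)).
pose f2 H1 : hdual h := linfun (F1 H1).
have lin2 : linear f2.
  move=> k H1 H2; apply/lfunP => H3; rewrite add_lfunE scale_lfunE /f2 !lfunE /=.
  by rewrite /f1 linearP invformDl invformZl.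
pose F2 := HB.pack_for {linear subvs_of h -> hdual h} f2
  (GRing.isLinear.Build K (subvs_of h) (hdual h) _ f2 lin2).
by rewrite (_ : gamma h B = linfun F2) // lfunE /= [LHS]lfunE.
Qed.

Definition tvec al : subvs_of h := (gamma h B)^-1%VF al.

(** The dual bases give an explicit preimage of [al] under [gamma], so the inverse taken in [tvec]
    is a true one at [al]. *)
Lemma tvecP al H : B (vsval (tvec al)) (vsval H) = al H.
Proof.
rewrite -gammaE limg_lfunVK //.
have -> : al = gamma h B (\sum_i (al (tnth hs' i) : K) *: tnth hs i).
  have [_ hs'_basis hsB] := hs_dual; apply/lfunP => H'; rewrite gammaE.
  rewrite (coord_basis hs'_basis (memvf H')) !linear_sum /= invform_sumr.
  apply: eq_bigr => j _; rewrite !linearZ /= invformZr invform_suml.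
  rewrite (bigD1 j) //= big1 => [|i ij].
    by rewrite invformZl -tnth_nth hsB eqxx mulr1 addr0.
  by rewrite invformZl -tnth_nth hsB (negPf ij) mulr0.
exact: memv_img (memvf _).
Qed.

Lemma dual_formE al be : dual_form B al be = al (tvec be).
Proof. by []. Qed.

Lemma tvec_sym al be : al (tvec be) = be (tvec al).
Proof. by rewrite -tvecP invform_sym tvecP. Qed.

Lemma tvec_eq0 al : tvec al = 0 -> al = 0.
Proof.
move=> t0; apply/lfunP => H.
by rewrite -tvecP t0 linear0 invform0l zero_lfunE.
Qed.

(** The bracket has weight 0, so it lies in h, where it is determined by its pairing with each H;
    invariance computes that pairing as B(y,z) al(H). *)
Lemma lie_opposite al y z : root_vector al y -> root_vector (- al) z ->
  [lie y, z] = B y z *: vsval (tvec al).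
Proof.
move=> aly alz; have yz_h : [lie y, z] \in h.
  by apply/weight0P; rewrite -(subrr al); exact: root_vector_lie.
rewrite -(vsprojK yz_h) -linearZ; congr vsval; apply: invform_h_inj => H.
rewrite linearZ invformZl tvecP vsprojK // invform_inv lieC alz.
by rewrite -scaleNr invformZr opp_lfunE opprK mulrC.
Qed.

(** * Vanishing traces of commutators, and multiplicities of roots *)

Definition index_stable (P : pred I) z : Prop :=
  forall i j, P i -> co j [lie z, bs`_i] != 0 -> P j.

(* The left-hand side is the trace of [ad y, ad z] on the span of the bs`_i
   with P i, which both operators preserve. *)
Lemma trace_commutator (P : pred I) y z H : [lie y, z] = vsval H ->
  index_stable P y -> index_stable P z -> \sum_(i | P i) (mu i H : K) = 0.
Proof.
move=> yzH yP zP.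
have co_lie (w w' : g) (i : I) : index_stable P w' -> P i ->
    co i [lie w, [lie w', bs`_i]] =
    \sum_(j | P j) co j [lie w', bs`_i] * co i [lie w, bs`_j].
  move=> w'P Pi; rewrite {1}(coordE [lie w', _]) !linear_sum [RHS]big_mkcond /=.
  apply: eq_bigr => j _; rewrite lieZr linearZ /=; case: ifP => // Pj.
  have [->|] := eqVneq (co j [lie w', bs`_i]) 0; first by rewrite mul0r.
  by move/(w'P _ _ Pi); rewrite Pj.
have -> : \sum_(i | P i) (mu i H : K) =
    \sum_(i | P i) (co i [lie y, [lie z, bs`_i]] - co i [lie z, [lie y, bs`_i]]).
  apply: eq_bigr => i _; rewrite -linearB /= lie_derivation addrK yzH.
  by rewrite coord_ad coord_bs eqxx mulr1.
rewrite sumrB; under eq_bigr => i Pi do rewrite co_lie //.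
under [X in _ - X]eq_bigr => i Pi do rewrite co_lie //.
rewrite [X in _ - X]exchange_big /= -sumrB big1 // => i _.
by rewrite -sumrB big1 // => j _; rewrite mulrC subrr.
Qed.

Lemma coord_lie_weight al y (i j : I) : root_vector al y ->
  co j [lie y, bs`_i] != 0 -> mu j = mu i + al.
Proof.
move=> aly yij; rewrite addrC; apply: weight_coord yij.
exact: root_vector_lie.
Qed.

(** On the [al]-string of weight spaces through any mu_i, the element t_al acts by the constant
    mu_i(t_al). It is proportional to a commutator preserving the string, so the constant is 0;
    hence t_al is central and vanishes. *)
Lemma isotropic_weight al y : root_vector al y -> y <> 0 ->
  al (tvec al) = 0 -> al = 0.
Proof.
move=> aly y_n0 al_iso; have [i0 mu_i0 By] := dual_weight aly y_n0.
have al_z : root_vector (- al) bs`_i0 by rewrite -mu_i0.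
suff mu_t (i : I) : mu i (tvec al) = 0.
  apply: tvec_eq0; apply: val_inj; apply: center_trivial => z.
  rewrite (coordE z) linear_sum big1 // => i _ /=.
  by rewrite lieZr bs_wt mu_t scale0r scaler0.
pose P (j : I) := `[< exists m : int, mu j = mu i + al *~ m >].
have step (e : int) z : root_vector (al *~ e) z -> index_stable P z.
  move=> ez j k /asboolP[m mu_j] /(coord_lie_weight ez) mu_k.
  by apply/asboolP; exists (m + e); rewrite mu_k mu_j mulrzDr addrA.
have Pi : P i by apply/asboolP; exists 0; rewrite addr0.
have := @trace_commutator P y bs`_i0 (B y bs`_i0 *: tvec al).
rewrite (lie_opposite aly al_z) linearZ => /(_ erefl).
move=> /(_ (step 1 _ aly)) /(_ (step (-1) _ al_z)).
under eq_bigr => j Pj.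
  rewrite linearZ /=; have -> : mu j (tvec al) = mu i (tvec al).
    have /asboolP[m ->] := Pj; rewrite add_lfunE -scaler_int scale_lfunE al_iso.
    by rewrite scaler0 addr0.
  over.
rewrite sumr_const => /eqP; rewrite mulrn_eq0 mulf_eq0 (negPf By) /=.
by case/orP => [/eqP/card0_eq/(_ i)|/eqP //]; rewrite [LHS]Pi.
Qed.

(** The span of one vector of weight -al, of h, and of all weight spaces for positive multiples of
    al is stable under a pair of opposite root vectors. The trace of t_al on it is (-1 + sum of the
    multiples) al(t_al) = 0, so the multiples add up to 1. Root spaces are thus one-dimensional, and
    no k al with k > 1 is a root. *)
Lemma weight_multiple (i j : I) k : mu j <> 0 -> mu i = mu j *+ k.+1 -> i = j.
Proof.
set al := mu j => al_n0 mu_i.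
have al_j : root_vector al bs`_j by exact: bs_wt.
have bsj_n0 : bs`_j <> 0 by apply/eqP; exact: weight_basis_neq0.
have [i0 mu_i0 By] := dual_weight al_j bsj_n0.
have al_i0 : root_vector (- al) bs`_i0 by rewrite -mu_i0.
have al_mul0 m : al *+ m = 0 -> m = 0%N.
  by move/eqP; rewrite -scaler_nat scaler_eq0 pnatr_eq0 => /orP[/eqP //|/eqP].
pose Q (l : I) := `[< exists m, mu l = al *+ m >].
pose P (l : I) := (l == i0) || Q l.
have P_e : index_stable P bs`_j.
  move=> l l' /orP[/eqP ->|/asboolP[m mu_l]] /(coord_lie_weight al_j) mu_l';
    apply/orP; right; apply/asboolP.
  - by exists 0%N; rewrite mu_l' mu_i0 addNr.
  - by exists m.+1; rewrite mu_l' mu_l mulrS addrC.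
have P_f : index_stable P bs`_i0.
  move=> l l' /orP[/eqP ->|/asboolP[[|m] mu_l]].
  - by rewrite liexx linear0 eqxx.
  - have /weight0P lh : root_vector (0 : hdual h) bs`_l by rewrite -(mulr0n al) -mu_l.
    (* An element of h sends the chosen vector of weight -al to a multiple of itself, so one such
       vector suffices for stability. *)
    rewrite lieC -(vsprojK lh) bs_wt linearN linearZ /= coord_bs oppr_eq0.
    by case: (eqVneq i0 l') => [<- _|_]; [rewrite /P eqxx | rewrite mulr0 eqxx].
  - move/(coord_lie_weight al_i0) => mu_l'; apply/orP; right; apply/asboolP.
    by exists m; rewrite mu_l' mu_l mulrSr addrK.
have al_t : al (tvec al) <> 0 by move/(isotropic_weight al_j bsj_n0).
have := trace_commutator (H := B bs`_j bs`_i0 *: tvec al) _ P_e P_f.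
rewrite (lie_opposite al_j al_i0) linearZ => /(_ erefl).
under eq_bigr do rewrite linearZ /=.
rewrite -mulr_sumr => /eqP; rewrite mulf_eq0 (negPf By) /= => /eqP sum0.
pose c (l : I) : nat := if pselect (exists m, mu l = al *+ m) is left ex
  then projT1 (cid ex) else 0%N.
have cP l : Q l -> mu l = al *+ c l.
  move=> /asboolP Ql; rewrite /c; case: pselect => // ex; exact: projT2 (cid ex).
have nQ_i0 : Q i0 = false.
  apply/negP => /cP; rewrite mu_i0 => /eqP; rewrite eq_sym -subr_eq0 opprK -mulrSr.
  by move=> /eqP/al_mul0.
have : (\sum_(l | Q l) c l)%:R * (al (tvec al) : K) = al (tvec al).
  apply/eqP; rewrite natr_sum mulr_suml -subr_eq0 -[X in _ == X]sum0 eq_sym.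
  rewrite (bigD1 i0) /=; last by rewrite /P eqxx.
  rewrite mu_i0 opp_lfunE addrC; apply/eqP; congr (_ - _).
  apply: eq_big => [l|l /andP[Pl ll]]; last first.
    have Ql : Q l by move: Pl; rewrite /P (negPf ll).
    by rewrite (cP l Ql) -scaler_nat scale_lfunE.
  by rewrite /P; case: eqP => [->|_]; rewrite ?nQ_i0 ?andbT.
rewrite -[RHS]mul1r => /mulIf => /(_ (introN eqP al_t)) /eqP.
rewrite -[1]/(1%:R) eqr_nat => /eqP sum1.
have Qi : Q i by apply/asboolP; exists k.+1.
have Qj : Q j by apply/asboolP; exists 1%N.
have c_gt0 l : Q l -> mu l <> 0 -> (0 < c l)%N.
  move=> /cP; case: (c l) => // -> //.
(* Distinct [i] and [j] would each contribute at least 1 to a sum equal to 1. *)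
apply/eqP/negPn/negP => ij; move: sum1.
rewrite (bigD1 i) //= (bigD1 j) /=; last by rewrite Qj eq_sym.
have : (0 < c i)%N by apply: c_gt0 => //; rewrite mu_i => /al_mul0.
have : (0 < c j)%N by exact: c_gt0.
by case: (c i) => // a; case: (c j) => // b _ _; rewrite addSn addnS.
Qed.

(** * The finite list of roots *)

Definition root_seq : seq (hdual h) := [seq mu i | i <- enum I & mu i != 0].

Lemma root_seqP al : reflect (exists2 i, mu i != 0 & al = mu i) (al \in root_seq).
Proof.
rewrite /root_seq; apply: (iffP mapP) => [ [k] |[i mu_i ->] ].
  by rewrite mem_filter => /andP[mu_k _] ->; exists k.
by exists i; rewrite // mem_filter mu_i mem_enum.
Qed.

Lemma mem_root_seq al : roots al <-> al \in root_seq.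
Proof.
split=> [[al_n0 [y y_n0 aly]]|/root_seqP[i /eqP mu_n0 ->]]; last first.
  split=> //.
  exists bs`_i; last exact: bs_wt.
  by apply/eqP; exact: weight_basis_neq0.
have [i mu_i _] : exists2 i : I, mu i = al & true.
  have [i _ _] := dual_weight aly y_n0.
  apply/not_exists2P => noi; apply: y_n0; rewrite (coordE y) big1 // => j _.
  have [->|yj] := eqVneq (co j y) 0; first by rewrite scale0r.
  by have [/(_ (weight_coord aly yj))|] := noi j.
by apply/root_seqP; exists i; rewrite // mu_i; exact/eqP.
Qed.

Lemma root_seq_uniq : uniq root_seq.
Proof.
rewrite map_inj_in_uniq ?(filter_uniq _ (enum_uniq _)) // => i j _.
by rewrite mem_filter => /andP[/eqP mu_j _] mu_ij; exact: (@weight_multiple i j 0).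
Qed.

Lemma rootN al : roots al -> roots (- al).
Proof.
move=> [al_n0 [y y_n0 aly]]; have [i mu_i By] := dual_weight aly y_n0.
split; first by move/eqP; rewrite oppr_eq0 => /eqP.
by exists bs`_i; rewrite -?mu_i //; apply/eqP; exact: weight_basis_neq0.
Qed.

Lemma root_space al y z : roots al -> root_vector al y -> y <> 0 ->
  root_vector al z -> exists c : K, z = c *: y.
Proof.
move=> /mem_root_seq/root_seqP[i /eqP mu_i al_i].
have pr1 (j : I) : (mu j == al) = (j == i).
  apply/eqP/eqP => [|-> //]; rewrite al_i => mu_ji.
  exact: (@weight_multiple j i 0).
move=> /weight_expand; rewrite (eq_bigl _ _ pr1) big_pred1_eq => yE y_n0.
move=> /weight_expand; rewrite (eq_bigl _ _ pr1) big_pred1_eq => zE.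
exists (co i z / co i y); rewrite [LHS]zE; move: yE; set k := co i y => yE.
rewrite [in RHS]yE scalerA divfK //.
by apply/eqP => y0; apply: y_n0; rewrite yE y0 scale0r.
Qed.

(** * Simple roots, positivity and the sum of the positive roots *)

Variables (Pi : (\dim h).-tuple (hdual h)) (beta : hdual h).
Hypotheses (Pi_simple : simple_roots Pi) (beta_highest : highest_root Pi beta).

Lemma coord_nonneg al : nonneg_comb Pi al ->
  forall i, exists m : nat, coord Pi i al = m%:R.
Proof.
have [Pi_basis _ _] := Pi_simple; move=> [k ->] i; exists (k i).
under eq_bigr => j _ do rewrite (tnth_nth 0) -scaler_nat.
by rewrite coord_sum_free ?(basis_free Pi_basis).
Qed.

Lemma coordPiE al : al = \sum_i coord Pi i al *: tnth Pi i.
Proof.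
have [Pi_basis _ _] := Pi_simple.
rewrite {1}(coord_basis Pi_basis (memvf al)); apply: eq_bigr => i _.
by rewrite -tnth_nth.
Qed.

Lemma coord_Pi (i j : 'I_(\dim h)) : coord Pi j (tnth Pi i) = (i == j)%:R.
Proof.
have [Pi_basis _ _] := Pi_simple.
by rewrite (tnth_nth 0) coord_free ?(basis_free Pi_basis).
Qed.

Lemma nonneg_antisym al : nonneg_comb Pi al -> nonneg_comb Pi (- al) -> al = 0.
Proof.
move=> al_ge0 al_le0; rewrite (coordPiE al) big1 // => i _.
have [m mE] := coord_nonneg al_ge0 i; have [m' m'E] := coord_nonneg al_le0 i.
move: m'E; rewrite linearN /= mE => /eqP; rewrite eq_sym -subr_eq0 opprK -natrD.
by rewrite pnatr_eq0 addn_eq0 => /andP[_ /eqP->]; rewrite scale0r.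
Qed.

Lemma nonneg_combD al be :
  nonneg_comb Pi al -> nonneg_comb Pi be -> nonneg_comb Pi (al + be).
Proof.
move=> [k ->] [k' ->]; exists (fun i => k i + k' i)%N.
by rewrite -big_split; apply: eq_bigr => i _; rewrite /= mulrnDr.
Qed.

Lemma nonneg_simple s : nonneg_comb Pi (tnth Pi s).
Proof.
exists (fun i => (i == s) : nat); rewrite (bigD1 s) //= eqxx big1 ?addr0 //.
by move=> i /negPf->.
Qed.

(** Each coefficient of [al] is a natural number bounded by that of the simple root, hence 0 away
    from s and 0 or 1 at s. *)
Lemma nonneg_sub_simple al s : nonneg_comb Pi al ->
  nonneg_comb Pi (- (al - tnth Pi s)) -> al = 0 \/ al = tnth Pi s.
Proof.
move=> al_ge0 al_le; pose c i : nat := projT1 (cid (coord_nonneg al_ge0 i)).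
have cP i : coord Pi i al = (c i)%:R by exact: projT2 (cid (coord_nonneg al_ge0 i)).
have c_le i : (c i <= (s == i))%N.
  have [m] := coord_nonneg al_le i; rewrite opprB linearB /= coord_Pi cP => /eqP.
  by rewrite subr_eq -natrD eqr_nat => /eqP ->; rewrite leq_addl.
have alE : al = tnth Pi s *+ c s.
  rewrite {1}(coordPiE al) (bigD1 s) //= big1 ?addr0 => [|i is_].
    by rewrite cP scaler_nat.
  have := c_le i; rewrite eq_sym (negPf is_) leqn0 => /eqP ci0.
  by rewrite cP ci0 scale0r.
have := c_le s; rewrite eqxx alE; case: (c s) => [|[|//]] _; [by left | by right].
Qed.

Definition positive al : bool := `[< nonneg_comb Pi al >].

Lemma rootVpos al : roots al -> positive al \/ positive (- al).
Proof.
have [_ _ Pi_sign] := Pi_simple.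
by move=> /Pi_sign[] ?; [left|right]; apply/asboolP.
Qed.

Lemma positiveN al : roots al -> positive (- al) = ~~ positive al.
Proof.
move=> al_root; have [al_n0 _] := al_root; apply/idP/idP => [al_le0|].
  apply/negP => /asboolP al_ge0; apply: al_n0; apply: nonneg_antisym => //.
  exact/asboolP.
by have [->|->] := rootVpos al_root.
Qed.

Definition two_rho : hdual h := \sum_(al <- root_seq | positive al) al.

(* The e- and f-strings of a simple root preserve the sum of the positive root
   spaces other than its own, so the trace formula applies to that sum. *)
Lemma two_rho_simple s :
  two_rho (tvec (tnth Pi s)) = tnth Pi s (tvec (tnth Pi s)).
Proof.
have [_ Pi_roots Pi_sign] := Pi_simple.
set al := tnth Pi s; have al_root : roots al by exact: Pi_roots.
have [al_n0 _] := al_root.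
have /mem_root_seq/root_seqP[j mu_j al_j] := al_root.
have al_y : root_vector al bs`_j by rewrite al_j.
have y_n0 : bs`_j <> 0 by apply/eqP; exact: weight_basis_neq0.
have [i0 mu_i0 By] := dual_weight al_y y_n0.
have al_z : root_vector (- al) bs`_i0 by rewrite -mu_i0.
pose P (i : I) := [&& mu i != 0, positive (mu i) & i != j].
have P_e : index_stable P bs`_j.
  move=> i k /and3P[mu_i /asboolP i_pos ij] /(coord_lie_weight al_y) mu_k.
  have k_pos : nonneg_comb Pi (mu k).
    by rewrite mu_k; apply: nonneg_combD => //; exact: nonneg_simple.
  apply/and3P; split; last 2 first.
  - exact/asboolP.
  - apply: contra mu_i => /eqP kj; move/eqP: mu_k.
    by rewrite kj -al_j eq_sym -subr_eq0 addrK.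
  apply: contra mu_i => /eqP mu_k0; apply/eqP; apply: nonneg_antisym => //.
  have -> : - mu i = al; last exact: nonneg_simple.
  by apply/eqP; rewrite eq_sym -addr_eq0 addrC -mu_k mu_k0.
have P_f : index_stable P bs`_i0.
  move=> i k /and3P[mu_i /asboolP i_pos ij] /(coord_lie_weight al_z) mu_k.
  have mu_i_al : mu i <> al.
    move=> mu_al; move/eqP: ij; apply; apply: (@weight_multiple i j 0).
      exact/eqP.
    by rewrite mu_al.
  have mu_k0 : mu k != 0.
    by apply/eqP; rewrite mu_k => /eqP; rewrite subr_eq0 => /eqP.
  have k_root : roots (mu k).
    by apply/mem_root_seq/root_seqP; exists k.
  apply/and3P; split=> //.
    apply/asboolP; have [//|k_neg] := Pi_sign _ k_root.
    rewrite mu_k in k_neg.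
    by have [mu0|//] := nonneg_sub_simple i_pos k_neg; rewrite mu0 eqxx in mu_i.
  apply/eqP => kj; move/eqP: ij; apply; apply: (@weight_multiple i j 1).
    exact/eqP.
  by rewrite mulr2n -al_j -[mu i](subrK al) -mu_k kj -al_j.
have := trace_commutator (H := B bs`_j bs`_i0 *: tvec al) _ P_e P_f.
rewrite (lie_opposite al_y al_z) linearZ => /(_ erefl).
under eq_bigr do rewrite linearZ /=.
rewrite -mulr_sumr => /eqP; rewrite mulf_eq0 (negPf By) /= => /eqP sum0.
rewrite /two_rho big_map big_filter_cond big_enum_cond /= sum_lfunE (bigD1 j) /=.
  rewrite -al_j -[RHS]addr0; congr (_ + _); rewrite -[RHS]sum0; apply: eq_bigl => i.
  by rewrite /P andbA.
by rewrite mu_j -al_j; apply/asboolP; exact: nonneg_simple.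
Qed.

Lemma two_rho_coroot s : two_rho (coroot B (tnth Pi s)) = 2 :> K.
Proof.
have [_ Pi_roots _] := Pi_simple; have [al_n0 [y y_n0 aly]] := Pi_roots s.
rewrite /coroot linearZ /= -/(tvec _) two_rho_simple dual_formE.
apply: divfK; apply/eqP => al_iso; apply: al_n0.
exact: isotropic_weight aly y_n0 al_iso.
Qed.

(** * Dual bases of g built from h and the root vectors *)

Variable x : hdual h -> g.
Hypothesis x_norm : normalized_root_vectors B x.

Let x_wt al : roots al -> root_vector al (x al).
Proof. by case/x_norm. Qed.

Let x_neq0 al : roots al -> x al <> 0.
Proof.
case/x_norm => _ Bx x0; move: Bx; rewrite x0 invform0l => /eqP.
by rewrite eq_sym oner_eq0.
Qed.

Lemma lie_root_opp al : roots al -> [lie x al, x (- al)] = vsval (tvec al).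
Proof.
move=> al_root; have [al_x Bx] := x_norm al_root.
by rewrite (lie_opposite al_x (x_wt (rootN al_root))) Bx scale1r.
Qed.

(** The vector of weight -al comes first, to match the order of the factors in [Omega1] and
    [Omega3]. *)
Definition dual_pairs : seq (g * g) :=
  [seq (vsval (tnth hs i), vsval (tnth hs' i)) | i <- enum 'I_(\dim h)]
  ++ [seq (x (- al), x al) | al <- root_seq].

Lemma sum_dual_pairs (V : zmodType) (F : g -> g -> V) :
  \sum_(p <- dual_pairs) F p.1 p.2 =
    \sum_i F (vsval (tnth hs i)) (vsval (tnth hs' i))
    + \sum_(al <- root_seq) F (x (- al)) (x al).
Proof. by rewrite big_cat /= 2!big_map big_enum. Qed.

Lemma root_opp_neq0 al be : al <> - be -> al + be <> 0.
Proof. by move=> al_be /eqP; rewrite addr_eq0 => /eqP. Qed.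

Lemma h_weight0 H : root_vector (0 : hdual h) (vsval H).
Proof. by apply/weight0P; exact: subvsP. Qed.

(** By linearity y may be a weight basis vector. In weight 0 only the pairs from h contribute;
    otherwise the vector is a multiple of x_al and pairs nontrivially with x_(-al) alone. *)
Lemma dual_pairs_expand y : y = \sum_(p <- dual_pairs) B y p.2 *: p.1.
Proof.
pose E y := \sum_(p <- dual_pairs) B y p.2 *: p.1.
suff E_bs (i : I) : E bs`_i = bs`_i.
  rewrite {1}(coordE y); under eq_bigr => i _ do rewrite -E_bs scaler_sumr.
  rewrite exchange_big; apply: eq_bigr => p _ /=.
  rewrite [in RHS](coordE y) invform_suml scaler_suml; apply: eq_bigr => i _.
  by rewrite scalerA invformZl.
rewrite /E (sum_dual_pairs (fun u v => B bs`_i v *: u)).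
have [mu_i|mu_i] := eqVneq (mu i) 0.
  have /weight0P ih : root_vector (0 : hdual h) bs`_i by rewrite -mu_i.
  rewrite -(vsprojK ih); set H := vsproj h _.
  rewrite [X in _ + X]big_seq_cond [X in _ + X]big1 ?addr0.
    by rewrite [in RHS](h_expand H) linear_sum.
  move=> al /andP[/mem_root_seq al_root _]; have [al_n0 _] := al_root.
  by rewrite (invform_weight (h_weight0 H) (x_wt al_root)) ?scale0r ?add0r.
set al := mu i in mu_i; have al_root : roots al.
  by apply/mem_root_seq/root_seqP; exists i.
have [c ->] := root_space al_root (x_wt al_root) (@x_neq0 _ al_root) (bs_wt i).
rewrite big1 ?add0r => [|j _]; last first.
  rewrite (invform_weight (root_vectorZ c (x_wt al_root)) (h_weight0 _)) ?scale0r //.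
  by rewrite addr0; exact/eqP.
have /mem_root_seq Nal_in := rootN al_root.
rewrite (bigD1_seq (- al)) ?root_seq_uniq //= [X in _ + X]big_seq_cond.
rewrite [X in _ + X]big1 => [|be /andP[/mem_root_seq be_root be_al]].
  by rewrite addr0 opprK invformZl (x_norm al_root).2 mulr1.
rewrite (invform_weight (root_vectorZ c (x_wt al_root)) (x_wt be_root)) ?scale0r //.
by apply: root_opp_neq0 => al_be; move/eqP: be_al; apply; rewrite al_be opprK.
Qed.

Lemma dual_pairs_dual : dual_family B dual_pairs.
Proof.
split=> y; first exact: dual_pairs_expand.
(* The second expansion follows from the first by pairing with an arbitrary z. *)
apply/eqP; rewrite -subr_eq0; apply/eqP; apply: invform_nondegenerate => z.
rewrite invformDl invformNl {1}(dual_pairs_expand z) invform_sumr invform_suml.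
apply/eqP; rewrite subr_eq0; apply/eqP; apply: eq_bigr => p _.
by rewrite invformZl invformZr mulrC invform_sym (invform_sym B z).
Qed.

(** * The Casimir eigenvalue and the dual Coxeter number *)

Hypothesis beta_norm : dual_form B beta beta = 2.

Lemma coroot_beta : coroot B beta = tvec beta.
Proof. by rewrite /coroot beta_norm divff ?scale1r // pnatr_eq0. Qed.

(** Since (beta, beta) = 2, t_beta is the coroot of beta. Its coefficients in the simple coroots are
    the dual Kac labels, and 2 rho takes the value 2 on each simple coroot. *)
Lemma two_rho_beta : 2 + (two_rho (tvec beta) : K) = 2 * dual_coxeter Pi B beta.
Proof.
rewrite /dual_coxeter mulrDr mulr1; congr (_ + _); rewrite -coroot_beta.
set co_Pi := [tuple _ | i < _].
have co_nth (s : 'I_(\dim h)) : co_Pi`_s = coroot B (tnth Pi s).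
  by rewrite -tnth_nth tnth_mktuple.
(* [coord] expands only vectors in the span of the family, so the coroot of beta must be shown to
   lie in it. *)
have tvec_span (s : 'I_(\dim h)) : tvec (tnth Pi s) \in <<co_Pi>>%VS.
  have [_ Pi_roots _] := Pi_simple; have [al_n0 [y y_n0 aly]] := Pi_roots s.
  have iso : tnth Pi s (tvec (tnth Pi s)) != 0 :> K.
    by apply/eqP => /(isotropic_weight aly y_n0).
  have -> : tvec (tnth Pi s) = (tnth Pi s (tvec (tnth Pi s)) / 2 : K) *: co_Pi`_s.
    rewrite co_nth /coroot scalerA dual_formE mulrA divfK ?pnatr_eq0 //.
    by rewrite divff // scale1r.
  by rewrite rpredZ // memv_span // mem_nth // size_tuple.
have /coord_span betaE : coroot B beta \in <<co_Pi>>%VS.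
  rewrite coroot_beta {1}(coordPiE beta) /tvec linear_sum rpred_sum // => s _.
  by rewrite linearZ rpredZ //; exact: tvec_span.
rewrite {1}betaE linear_sum mulr_sumr; apply: eq_bigr => s _.
rewrite linearZ /= -[X in two_rho X]/(co_Pi`_s) co_nth two_rho_coroot.
exact: mulrC.
Qed.

(** A nonzero bracket would make beta + al a root above beta, unless beta + al = 0; in that case
    beta - al = -2 al is nonnegative by maximality, against al > 0. *)
Lemma bracket_highest al : roots al -> positive al -> [lie x beta, x al] = 0.
Proof.
have [beta_root beta_max] := beta_highest.
move=> al_root /asboolP al_pos; have [al_n0 _] := al_root.
have ab_wt := root_vector_lie (x_wt beta_root) (x_wt al_root).
apply/eqP/negPn/negP => /eqP ab_n0; apply: al_n0.
have [ab0|/eqP ab_root] := eqVneq (beta + al) 0.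
  have al2_0 : al + al = 0.
    apply: nonneg_antisym; first exact: nonneg_combD.
    have -> : - (al + al) = beta - al.
      by rewrite opprD; congr (_ - _); apply/eqP; rewrite eq_sym -addr_eq0 ab0.
    exact: beta_max.
  by move/eqP: al2_0; rewrite -mulr2n -scaler_nat scaler_eq0 pnatr_eq0 => /eqP.
apply: nonneg_antisym => //.
have := beta_max (beta + al); rewrite opprD addNKr; apply.
by split=> //; exists [lie x beta, x al].
Qed.

(** The pairs from h contribute (beta, beta) = 2. For al positive, [x_beta, x_al] = 0 turns the term
    into [x_beta, [x_(-al), x_al]] = (beta, al) x_beta, and for al negative the inner bracket
    vanishes; the total is 2 + 2 rho(t_beta). *)
Lemma casimir_beta :
  \sum_(p <- dual_pairs) [lie [lie x beta, p.1], p.2] =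
    (2 * dual_coxeter Pi B beta) *: x beta.
Proof.
have [beta_root _] := beta_highest.
rewrite (sum_dual_pairs (fun u v => [lie [lie x beta, u], v])) -two_rho_beta.
rewrite scalerDl; congr (_ + _).
  rewrite -beta_norm dual_formE {1}(h_expand (tvec beta)) linear_sum scaler_suml.
  apply: eq_bigr => i _; rewrite linearZ /= tvecP.
  have beta_h H y : root_vector beta y -> [lie y, vsval H] = - (beta H : K) *: y.
    by move=> beta_y; rewrite lieC beta_y scaleNr.
  rewrite (beta_h _ _ (x_wt beta_root)) lieZl (beta_h _ _ (x_wt beta_root)).
  by rewrite scalerA mulrNN mulrC.
rewrite (bigID positive) /= [X in _ + X]big_seq_cond [X in _ + X]big1 ?addr0.
  rewrite sum_lfunE scaler_suml big_seq_cond [RHS]big_seq_cond.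
  apply: eq_bigr => al /andP[/mem_root_seq al_root al_pos].
  have -> : [lie [lie x beta, x (- al)], x al] = [lie x beta, [lie x (- al), x al]].
    by rewrite [RHS]lie_derivation (bracket_highest al_root al_pos) lie0r addr0.
  rewrite [ [lie x (- al), _] ]lieC lie_root_opp // linearN /= -lieC.
  by rewrite (x_wt beta_root) tvec_sym.
move=> al /andP[/mem_root_seq al_root]; rewrite -positiveN // => Nal_pos.
by rewrite bracket_highest ?lie0l //; exact: rootN.
Qed.

(** The eigenspace for this value is an ideal containing the nonzero vector x_beta, hence all of
    g. *)
Lemma casimir_scalar y :
  \sum_(p <- dual_pairs) [lie [lie y, p.1], p.2] =
    (2 * dual_coxeter Pi B beta) *: y.
Proof.
set c := 2 * _.
pose C z := \sum_(p <- dual_pairs) [lie [lie z, p.1], p.2] - c *: z.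
have C_lin : linear C.
  move=> k z w; rewrite /C scalerBr addrACA -opprD.
  congr (_ - _); last by rewrite scalerDr !scalerA mulrC.
  rewrite scaler_sumr -big_split; apply: eq_bigr => p _ /=.
  by rewrite lieDl lieZl lieDl lieZl.
pose CL := HB.pack_for {linear g -> g} C (GRing.isLinear.Build K g g _ C C_lin).
have kerP z : (z \in lker (linfun CL)) = (C z == 0) by rewrite memv_ker lfunE.
have [beta_root _] := beta_highest.
have [_ /(_ (lker (linfun CL)))[|ker0|ker_full]] := g_simple.
- move=> z w; rewrite !kerP /C (casimir_lie w z dual_pairs_dual) -linearZ -linearB /=.
  by move=> /eqP ->; rewrite linear0.
- have : x beta \in lker (linfun CL) by rewrite kerP /C casimir_beta subrr.
  by rewrite ker0 memv0 => /eqP /(x_neq0 beta_root).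
have : y \in lker (linfun CL) by rewrite ker_full memvf.
by rewrite kerP subr_eq0 => /eqP.
Qed.

(** * Heights of affine roots *)

Lemma two_beta_nonneg : nonneg_comb Pi (beta + beta).
Proof.
have [beta_root beta_max] := beta_highest.
by rewrite -[X in _ + X]opprK; apply: beta_max; exact: rootN.
Qed.

Definition root_height al : K := \sum_i coord Pi i al.

Lemma root_height_nonneg al : nonneg_comb Pi al ->
  exists m : nat, root_height al = m%:R.
Proof.
move=> /coord_nonneg al_ge0; have [c cP] := choice al_ge0.
by exists (\sum_i c i)%N; rewrite natr_sum; apply: eq_bigr.
Qed.

Lemma root_heightD al be : root_height (al + be) = root_height al + root_height be.
Proof. by rewrite /root_height -big_split; apply: eq_bigr => i _; rewrite linearD. Qed.

Lemma root_height_beta : 0 <= root_height beta.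
Proof.
have [m mE] := root_height_nonneg two_beta_nonneg.
by rewrite -(pmulrn_lge0 _ (isT : (0 < 2)%N)) mulr2n -root_heightD mE ler0n.
Qed.

Lemma root_height_bound al : roots al \/ al = 0 ->
  exists m : nat, - (m%:R) <= root_height al.
Proof.
case=> [al_root|->]; last first.
  by exists 0%N; rewrite oppr0 /root_height big1 // => i _; rewrite linear0.
have [/asboolP/root_height_nonneg[m mE]|/asboolP/root_height_nonneg[m mE]] :=
    rootVpos al_root.
  by exists 0%N; rewrite mE oppr0 ler0n.
exists m; rewrite -mE (_ : root_height (- al) = - root_height al) ?opprK //.
by rewrite /root_height -sumrN; apply: eq_bigr => i _; rewrite linearN.
Qed.

(** The height of al + n delta is n + ht(al) + n ht(beta) with ht(beta) >= 0, so the height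
    condition of category O becomes a lower bound on n. *)
Lemma height_bound al (N : nat) : roots al \/ al = 0 ->
  exists N1 : nat, forall n : int, N1%:Z <= n -> N%:R <= height Pi beta al n.
Proof.
move=> /root_height_bound[m m_le]; exists (N + m)%N => n le_n.
have n_ge0 : 0 <= n by lia.
have -> : height Pi beta al n = n%:~R + (root_height al + root_height beta *~ n).
  rewrite /height; congr (_ + _); rewrite /root_height mulrz_suml -big_split.
  by apply: eq_bigr => i _; rewrite linearD raddfMz.
have le1 : N%:R + m%:R <= n%:~R :> K.
  by rewrite -natrD (_ : (N + m)%:R = (N + m)%:Z%:~R) // ler_int.
have le2 : 0 <= root_height beta *~ n by rewrite mulrz_ge0 // root_height_beta.
rewrite -[N%:R](addrK m%:R) -[N%:R + m%:R - m%:R]addr0 [leRHS]addrA lerD //.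
exact: lerD.
Qed.

(** * Identification of Omega with the Sugawara operator on category O *)

Section Modules.
Variables (A : comAlgType K) (V : lmodType K) (M : currentModule (tau B) A V).

(** Each weight basis vector times t^n is an affine root vector, and the finitely many resulting
    bounds have a maximum. *)
Lemma category_O_smooth : category_O Pi beta M -> smooth M.
Proof.
case=> _ _ M_nil v a; have [N MN] := M_nil v a.
have bs_nil (i : I) : exists N1 : nat, forall n : int, N1%:Z <= n ->
    M (tau_loop B n bs`_i) a v = 0.
  have [mu_i|mu_i] := eqVneq (mu i) 0.
    have [N1 N1P] := @height_bound 0 N (or_intror erefl).
    (* The successor forces n > 0, so that n delta is a positive root. *)
    exists N1.+1 => n le_n; apply: (MN 0 n).
    - by split; [right; split=> // n0; move: le_n; rewrite n0 | left; lia].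
    - by apply: N1P; lia.
    have /weight0P ih : root_vector (0 : hdual h) bs`_i by rewrite -mu_i.
    right; split=> //; first by move=> n0; move: le_n; rewrite n0.
    by exists (vsproj h bs`_i), 0; rewrite scale0r addr0 vsprojK.
  have i_root : roots (mu i) by apply/mem_root_seq/root_seqP; exists i.
  have [N1 N1P] := height_bound N (or_introl i_root).
  exists N1.+1 => n le_n; apply: (MN (mu i) n).
  - by split; [left | left; lia].
  - by apply: N1P; lia.
  by left; split=> //; exists bs`_i.
have [N1 N1P] := choice bs_nil.
exists (\max_i N1 i) => n y le_n.
rewrite (coordE y) loop_act_sum big1 // => i _; rewrite N1P ?scaler0 //.
by apply: le_trans le_n; rewrite lez_nat; exact: leq_bigmax.
Qed.

Lemma fsum_pos_nat (F : nat -> V) (N : nat) :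
  (forall n, (N < n)%N -> F n = 0) ->
  \sum_(n \in [set n : nat | (0 < n)%N]%classic) F n = \sum_(1 <= n < N.+1) F n.
Proof.
move=> F0; rewrite (fsbigE (index_iota 1 N.+1)) ?iota_uniq //.
- rewrite big_seq_cond [RHS]big_seq_cond; apply: eq_bigl => n.
  rewrite mem_index_iota; case: (posnP n) => [->|n_gt0]; first by [].
  by rewrite mem_set // andbT.
- by move=> n /=; rewrite mem_index_iota => /andP[].
move=> n /= n_gt0; rewrite mem_index_iota n_gt0 /= ltnS -ltnNge; exact: F0.
Qed.

Lemma fsum_roots (F : hdual h -> V) :
  \sum_(al \in @roots K g h) F al = \sum_(al <- root_seq) F al.
Proof.
rewrite (@fsbig_seq _ _ _ _ _ F root_seq_uniq); apply: eq_fsbigl.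
by apply/seteqP; split=> al /mem_root_seq.
Qed.

Lemma fsum_pos_roots (W : zmodType) (F : hdual h -> W) :
  \sum_(al \in pos_roots Pi) F al = \sum_(al <- root_seq | positive al) F al.
Proof.
rewrite -[RHS]big_filter (@fsbig_seq _ _ _ _ _ F (filter_uniq _ root_seq_uniq)).
apply: eq_fsbigl; apply/seteqP; split=> al.
  move=> [/mem_root_seq al_in al_ge0] /=; rewrite mem_filter al_in andbT.
  exact/asboolP.
by rewrite /= mem_filter => /andP[/asboolP ? /mem_root_seq].
Qed.

Lemma sum_negative_roots (W : nmodType) (F : hdual h -> W) :
  \sum_(al <- root_seq | ~~ positive al) F al =
    \sum_(al <- root_seq | positive al) F (- al).
Proof.
have opp_perm : perm_eq root_seq [seq - al | al <- root_seq].
  apply: uniq_perm; rewrite ?root_seq_uniq //.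
    by rewrite map_inj_uniq ?root_seq_uniq //; exact: oppr_inj.
  move=> al; apply/idP/mapP => [/mem_root_seq/rootN/mem_root_seq al_in|].
    by exists (- al); rewrite ?opprK.
  by case=> be /mem_root_seq/rootN/mem_root_seq ? ->.
rewrite (perm_big _ opp_perm) big_map big_seq_cond [RHS]big_seq_cond.
apply: eq_bigl => al; apply/andP/andP => -[al_in al_pos]; split=> //;
  move: al_pos; rewrite positiveN ?negbK //; exact/mem_root_seq.
Qed.

Lemma rho_barE : rho_bar Pi = 2^-1 *: two_rho.
Proof. by rewrite /rho_bar fsum_pos_roots. Qed.

(** The terms of negative roots are x_al(a) x_(-al)(b) with al positive. Reordering them gives
    [Omega3] for (b,a) and the brackets t_al(ab), which add up to the finite part of 2
    gamma^-1(rho). *)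
Lemma sug_zero a b v : sug M dual_pairs 0 a b v =
  \sum_i M (tau_loop B 0 (vsval (tnth hs i))) a
            (M (tau_loop B 0 (vsval (tnth hs' i))) b v)
  + (Omega3 Pi M x a b v + Omega3 Pi M x b a v
  + M (tau_loop B 0 (vsval (tvec two_rho))) (a * b) v).
Proof.
rewrite /sug oppr0.
rewrite (sum_dual_pairs (fun y z => M (tau_loop B 0 y) a (M (tau_loop B 0 z) b v))).
congr (_ + _); rewrite (bigID positive) sum_negative_roots -addrA /=.
rewrite /Omega3 !fsum_pos_roots; congr (_ + _).
rewrite /two_rho /tvec linear_sum linear_sum.
rewrite (big_morph (fun y => M (tau_loop B 0 y) (a * b) v) (id1 := 0) (op1 := +%R));
  [|by move=> y z; rewrite linearD actDX|by rewrite linear0 act0X].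
rewrite -big_split big_seq_cond [RHS]big_seq_cond.
apply: eq_bigr => al /andP[/mem_root_seq al_root _] /=.
rewrite opprK loop_comm lie_root_opp // add0r eqxx mul0r scale0r addr0.
by [].
Qed.

(** Beyond the smoothness bounds of v the sums over n > 0 have no further terms; in degree 0, 2
    gamma^-1(rho) splits into the part absorbed by S_0 and the multiple of d. *)
Lemma Omega_sugawara a b v : smooth M ->
  exists N0 : nat, forall N : nat, (N0 <= N)%N ->
    Omega Pi beta M hs hs' x a b v =
      sugawara M dual_pairs (2 * dual_coxeter Pi B beta) N a b v.
Proof.
move=> M_smooth; have [Na NaP] := M_smooth v a; have [Nb NbP] := M_smooth v b.
exists (maxn Na Nb) => N; rewrite geq_max => /andP[le_aN le_bN].
have fsumE (k l : A) (Nl : nat) (y z : g) : (Nl <= N)%N ->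
    (forall n y, Nl%:Z <= n -> M (tau_loop B n y) l v = 0) ->
    \sum_(n \in [set n : nat | (0 < n)%N]%classic)
      M (tau_loop B (- n%:Z) y) k (M (tau_loop B n%:Z z) l v) =
    \sum_(1 <= n < N.+1) M (tau_loop B (- n%:Z) y) k (M (tau_loop B n%:Z z) l v).
  move=> le_N lP; apply: fsum_pos_nat => n lt_Nn.
  by rewrite lP ?linear0 //; lia.
have OmegaE (k l : A) (Nl : nat) : (Nl <= N)%N ->
    (forall n y, Nl%:Z <= n -> M (tau_loop B n y) l v = 0) ->
    \sum_(1 <= n < N.+1) sug M dual_pairs n k l v =
    Omega2 M hs hs' k l v + Omega1 M x k l v.
  move=> le_N lP; rewrite /Omega2 /Omega1 fsum_roots.
  under [in RHS]eq_bigr => i _ do rewrite (fsumE _ _ Nl) //.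
  under [X in _ = _ + X]eq_bigr => al _ do rewrite (fsumE _ _ Nl) //.
  rewrite [X in _ = X + _]exchange_big [X in _ = _ + X]exchange_big -big_split /=.
  apply: eq_bigr => n _; rewrite /sug.
  exact: (sum_dual_pairs (fun y z =>
    M (tau_loop B (- n%:Z) y) k (M (tau_loop B n%:Z z) l v))).
rewrite /Omega /sugawara sug_zero big_split /= (OmegaE a b Nb) // (OmegaE b a Na) //.
rewrite /gamma_inv_rho rho_barE actDX actZX scalerDr scalerA.
have -> : 2 *: M (tau_loop B 0 (vsval ((gamma h B)^-1%VF (2^-1 *: two_rho)))) (a * b) v
    = M (tau_loop B 0 (vsval (tvec two_rho))) (a * b) v.
  rewrite -actZX; congr (cact M _ _ _).
  by rewrite linearZ /= linearZ /= scalerA divff ?scale1r // pnatr_eq0.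
by rewrite [LHS](AC (5*2*2*2) (3*(10*11*1)*2*4*5*((8*6)*(9*7))))%AC.
Qed.

Lemma sugawara_linear c N a b : linear (sugawara M dual_pairs c N a b).
Proof.
have sug_linear n k l w v v' : sug M dual_pairs n k l (w *: v + v') =
    w *: sug M dual_pairs n k l v + sug M dual_pairs n k l v'.
  rewrite /sug scaler_sumr -big_split; apply: eq_bigr => p _ /=.
  by rewrite !linearP.
move=> w v v'; rewrite /sugawara !linearP /= sug_linear.
under eq_bigr => n _ do rewrite !sug_linear addrACA -scalerDr.
rewrite big_split -scaler_sumr /= !scalerDr.
by rewrite [LHS](AC (2*2*2*2*2) (1*3*5*7*9*(2*4*6*8*10)))%AC.
Qed.

(** * Commutation with the affine algebra *)

Hypothesis M_smooth : smooth M.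
Local Notation Om a b := (Omega Pi beta M hs hs' x a b).

(** The truncation degree depends on the vector; one that is large enough for all three vectors
    reduces the claim to [sugawara_linear]. *)
Lemma Omega_linear a b : linear (Om a b).
Proof.
move=> w v v'; have [N1 E1] := Omega_sugawara a b v M_smooth.
have [N2 E2] := Omega_sugawara a b v' M_smooth.
have [N3 E3] := Omega_sugawara a b (w *: v + v') M_smooth.
pose N := maxn N1 (maxn N2 N3).
by rewrite (E1 N) 1?(E2 N) 1?(E3 N) ?sugawara_linear // /N; lia.
Qed.

Lemma Omega_loop a b m y v :
  Om a b (M (tau_loop B m y) 1 v) = M (tau_loop B m y) 1 (Om a b v).
Proof.
have [N1 E1] := Omega_sugawara a b v M_smooth.
have [N2 E2] := Omega_sugawara a b (M (tau_loop B m y) 1 v) M_smooth.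
have [N3 E3] := sugawara_loop dual_pairs_dual casimir_scalar y m a b v M_smooth.
pose N := maxn N1 (maxn N2 N3).
by rewrite (E1 N) 1?(E2 N) 1?(E3 N) // /N; lia.
Qed.

Lemma Omega_K a b v : Om a b (M (tau_K B) 1 v) = M (tau_K B) 1 (Om a b v).
Proof.
have [N1 E1] := Omega_sugawara a b v M_smooth.
have [N2 E2] := Omega_sugawara a b (M (tau_K B) 1 v) M_smooth.
pose N := maxn N1 N2; rewrite (E1 N) 1?(E2 N); try by rewrite /N; lia.
have K1 X k w : M (tau_K B) 1 (M X k w) = M X k (M (tau_K B) 1 w) by exact: act_K.
have sugK n k l : M (tau_K B) 1 (sug M dual_pairs n k l v) =
    sug M dual_pairs n k l (M (tau_K B) 1 v).
  by rewrite /sug linear_sum; apply: eq_bigr => p _; rewrite /= !K1.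
rewrite /sugawara !linearD /= linearZ /= sugK linear_sum /= !K1.
by congr (_ + _); apply: eq_bigr => n _; rewrite linearD /= !sugK.
Qed.

Lemma Omega_affine_central a b : affine_central M (Om a b).
Proof.
have [OmD Om0 OmZ] : [/\ {morph Om a b : v w / v + w}, Om a b 0 = 0 &
    forall c v, Om a b (c *: v) = c *: Om a b v].
  pose L := HB.pack_for {linear V -> V} (Om a b)
    (GRing.isLinear.Build K V V _ (Om a b) (@Omega_linear a b)).
  by split=> [v w||c v]; [exact: (linearD L)|exact: (linear0 L)|exact: (linearZ_LR L)].
move=> X X_aff; have [s XE] := tau_decomp X.
pose C X := forall v, Om a b (M X 1 v) = M X 1 (Om a b v).
have CD Y Z : C Y -> C Z -> C (Y + Z).
  by move=> CY CZ v; rewrite !actDX OmD CY CZ.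
have CZ c Y : C Y -> C (c *: Y) by move=> CY v; rewrite !actZX OmZ CY.
suff : C X by [].
rewrite XE; apply: (CD); last by apply: CZ => v; exact: Omega_K.
apply: (big_ind C) => [v|Y Z|i _]; [by rewrite !act0X Om0|exact: CD|].
by rewrite X_aff scale0r addr0 => v; exact: Omega_loop.
Qed.

Lemma T_op_affine_central j a b :
  affine_central M (T_op Pi beta M hs hs' x j a b).
Proof.
move=> X X_aff v; rewrite /T_op; case: eqP => [_|_].
  exact: Omega_affine_central.
have OmC := @Omega_affine_central a b.
rewrite linearZ /=; congr (_ *: _).
(* As [L_j, X] stays in the affine algebra, [Omega] commutes with it as well. *)
have LX_aff n : vir_part [lie tau_vir B j, X] n = 0.
  by rewrite tau_lieE vir_part_lie fsbig1 // => i _; rewrite X_aff mulr0.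
have OmD v' w : Om a b (v' + w) = Om a b v' + Om a b w.
  by have := Omega_linear a b 1 v' w; rewrite !scale1r.
rewrite (OmC X X_aff) (act_comm M (tau_vir B j) X 1 1 (Om a b v)).
rewrite (act_comm M (tau_vir B j) X 1 1 v) OmD (OmC X X_aff) mulr1 (OmC _ LX_aff).
by rewrite opprD addrACA subrr addr0 linearB.
Qed.
End Modules.
End RootTheory.

Theorem theorem3p2 (R : realType) (g : finLieAlgType R[i]) (h : {vspace g})
    (Pi : (\dim h).-tuple (hdual h)) (beta : hdual h) (B : invForm g)
    (hs hs' : (\dim h).-tuple (subvs_of h)) (x : hdual h -> g)
    (A : comAlgType R[i]) :
  simple_lie g ->
  cartan_subalgebra h ->
  simple_roots Pi ->
  highest_root Pi beta ->
  dual_form B beta beta = 2 ->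
  dual_bases B hs hs' ->
  normalized_root_vectors B x ->
  finitely_generated A ->
  forall (j : int) (a b : A) (V : lmodType R[i]) (M : currentModule (tau B) A V),
    category_O Pi beta M ->
    affine_central M (T_op Pi beta M hs hs' x j a b).

Proof.
move=> g_simple h_cartan Pi_simple beta_highest beta_norm hs_dual x_norm _.
move=> j a b V M M_O; have [bs [mu [bs_basis bs_wt]]] := weight_basis h_cartan.
have M_smooth := category_O_smooth g_simple h_cartan hs_dual bs_basis bs_wt
  Pi_simple beta_highest M_O.
exact: (T_op_affine_central g_simple h_cartan hs_dual bs_basis bs_wt Pi_simple
  beta_highest x_norm beta_norm M_smooth).
Qed.
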